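(* Let $\mathcal{A}=(L\xrightarrow{\delta}E\xrightarrow{\partial}G,\triangleright,\{,\})$ and $\mathcal{A}'=(L'\xrightarrow{\delta}E'\xrightarrow{\partial}G',\triangleright,\{,\})$ be 2-crossed modules. There exists a (strict) 2-groupoid $\mathcal{HOM}_{\rm LAX}(\mathcal{A},\mathcal{A}')$ whose objects are the (strict) 2-crossed module maps $\mathcal{A}\to\mathcal{A}'$, whose morphisms are the (pointed) lax homotopies $f\xrightarrow{(f,\hat s,\hat t,\Pi)}f'$ between 2-crossed module maps, and whose 2-morphisms are the (pointed) lax 2-fold homotopies between lax homotopies, with the compositions described as follows. (1) Lax homotopies $f\xrightarrow{(f,\hat s,\hat t,\Pi)}f'\xrightarrow{(f',\hat s',\hat t',\Pi')}f''$, with $f=(\mu,\psi,\phi)$, $f'=(\mu',\psi',\phi')$, compose to $(f,\hat s\hat\otimes\hat s',\hat t\hat\otimes\hat t',\Pi\hat\otimes\Pi')$ with $(\hat s\hat\otimes\hat s')(g)=\hat s(g)\hat s'(g)$, $(\hat t\hat\otimes\hat t')(e)=\hat s'(\partial(e))^{-1}\triangleright'\hat t(e)\;\hat t'(e)$, $(\Pi\hat\otimes\Pi')(g,h)=\Theta(gh,g,h)\,\Pi'(g,h)\,\Pi(g,h)$, where for $x,y,z\in G$ $$\Theta(x,y,z)=\hat s'(z)^{-1}\triangleright'\{\hat s(z)^{-1},\phi(z)^{-1}\triangleright\hat s'(y)^{-1}\}\;\cdot$$ $$\big(\phi'(z)^{-1}\triangleright\hat s'(y)\,\hat s'(z)\big)^{-1}\triangleright'\Big(\Big\{\big(\phi(z)^{-1}\triangleright\hat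 s(y)\,\hat s(z)\big)^{-1},\big(\phi(yz)^{-1}\phi(x)\big)\triangleright\big(\hat s(x)\hat s'(x)\hat s(x)^{-1}\big)\Big\}\;\big(\phi'(yz)^{-1}\phi(x)\big)\triangleright\{\hat s(x),\hat s'(x)\}\Big).$$ (2) A lax 2-fold homotopy $(f,\hat s,\hat t,\Pi,\hat k)\colon(f,\hat s,\hat t,\Pi)\to(f,\hat s',\hat t',\Pi')$, between lax homotopies connecting the same two maps, is a map $\hat k\colon G\to L'$ with, for all $g,h\in G$, $e\in E$: $\hat s'(g)=\hat s(g)\,\delta(\hat k(g))$, $\hat t'(e)=\hat k(\partial(e))^{-1}\,\hat t(e)$, $\Pi'(g,h)=\Xi(gh,g,h)^{-1}\,\Pi(g,h)$, where for $x,y,z\in G$ $$\Xi(x,y,z)=\hat s(z)^{-1}\triangleright'\Big(\phi(z)^{-1}\triangleright\Big(\hat s(y)^{-1}\triangleright'\big((\phi(y)^{-1}\phi(x))\triangleright(\hat s(x)\triangleright'\hat k(x)^{-1})\big)\;\hat k(y)\Big)\Big)\;\hat k(z).$$ The vertical composition of $\hat k$ followed by $\hat k'$ is $g\mapsto\hat k(g)\hat k'(g)$. (3) The whiskering of $(f,\hat s,\hat t,\Pi,\hat k)$, a lax 2-fold homotopy between lax homotopies connecting $f$ and $f'$, with a lax homotopy $f'\xrightarrow{(f',\hat s'',\hat t'',\Pi'')}f''$ is given by the map $g\mapsto\hat s''(g)^{-1}\triangleright'\hat k(g)$ (a lax 2-fold homotopy with source $(f,\hat s,\hat t,\Pi)\hat\otimes(f',\hat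 s'',\hat t'',\Pi'')$), and its whiskering with a lax homotopy $f''\xrightarrow{(f'',\hat s'',\hat t'',\Pi'')}f$ is given by the map $g\mapsto\hat k(g)$ (with source $(f'',\hat s'',\hat t'',\Pi'')\hat\otimes(f,\hat s,\hat t,\Pi)$).
   Context: 2-crossed modules. A 2-crossed module $(L\xrightarrow{\delta}E\xrightarrow{\partial}G,\triangleright,\{,\})$ is a chain complex of groups ($\partial\circ\delta$ trivial) with left actions $\triangleright$ of $G$ by automorphisms on $L$ and $E$ ($G$ acts on itself by conjugation) such that $\delta,\partial$ are $G$-equivariant, and a $G$-equivariant map $\{,\}\colon E\times E\to L$ (so $g\triangleright\{e,f\}=\{g\triangleright e,g\triangleright f\}$) such that for all $e,f,g\in E$, $l,k\in L$: $\delta(\{e,f\})=efe^{-1}\,(\partial(e)\triangleright f^{-1})$; $lkl^{-1}k^{-1}=\{\delta(l),\delta(k)\}$; $\{\delta(l),e\}\{e,\delta(l)\}=l\,(\partial(e)\triangleright l^{-1})$; $\{ef,g\}=\{e,fgf^{-1}\}\,\partial(e)\triangleright\{f,g\}$; $\{e,fg\}=\{e,f\}\,(\partial(e)\triangleright f)\triangleright'\{e,g\}$, where $e\triangleright' l:=l\,\{\delta(l)^{-1},e\}$ (this is a left action of $E$ on $L$ by automorphisms). A map of 2-crossed modules $f=(\mu,\psi,\phi)$ consists of group homomorphisms on the $L$-, $E$- and $G$-groups respectively, commuting with $\delta,\partial$ and preserving the actions and the liftings $\{,\}$. Homotopies. Let $\mathcal{C}=(L_1\to E_1\to G_1)$,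 $\mathcal{D}=(L_2\to E_2\to G_2)$ be 2-crossed modules and $f=(\mu,\psi,\phi)\colon\mathcal{C}\to\mathcal{D}$ a map. A $\phi$-derivation is a map $s\colon G_1\to E_2$ with $s(gh)=(\phi(h)^{-1}\triangleright s(g))\,s(h)$. A quadratic $f$-derivation is a pair $(s,t)$ with $s\colon G_1\to E_2$ a $\phi$-derivation and $t\colon E_1\to L_2$ a map such that for all $a,b\in E_1$, $g\in G_1$: $$t(ab)=s(\partial(b))^{-1}\triangleright'\big(\{\psi(b)^{-1},s(\partial(a))^{-1}\}^{-1}\;\psi(b)^{-1}\triangleright' t(a)\big)\;t(b),$$ $$t(g\triangleright a)=\phi(g)\triangleright\Big(\big(s(g)s(\partial(a))^{-1}\big)\triangleright'\{\psi(a)^{-1},s(g)^{-1}\}^{-1}\Big)\;\phi(g)\triangleright\{s(g),s(\partial(a))^{-1}\psi(a)^{-1}\}\;\big(\phi(g)\partial(s(g))\big)\triangleright t(a).$$ Then $f'=(\mu',\psi',\phi')$ with $\mu'(l)=\mu(l)t(\delta(l))$, $\psi'(a)=\psi(a)s(\partial(a))\delta(t(a))$, $\phi'(g)=\phi(g)\partial(s(g))$ is a map $\mathcal{C}\to\mathcal{D}$; one writes $f\xrightarrow{(f,s,t)}f'$ and calls $(f,s,t)$ a homotopy connecting $f$ and $f'$. The resolution $Q^1(\mathcal{A})$. For a group $G$, $\mathcal{F}(G)$ is the free group on the underlying set of $G$, with basis $[G]=\{[g]:g\in G\}$, and $p\colon\mathcal{F}(G)\to G$ is the homomorphism with $p([g])=g$;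 $\emptyset$ is the identity of $\mathcal{F}(G)$. For $\mathcal{A}=(L\to E\to G)$ put $E\times_G\mathcal{F}(G)=\{(e,u):\partial(e)=p(u)\}$ and $Q^1(\mathcal{A})=(L\xrightarrow{\delta'}E\times_G\mathcal{F}(G)\xrightarrow{\partial'}\mathcal{F}(G))$ with $\delta'(l)=(\delta(l),\emptyset)$, $\partial'(e,u)=u$, $u\triangleright(e,u')=(p(u)\triangleright e,uu'u^{-1})$, $u\triangleright l=p(u)\triangleright l$, $\{(e,u),(e',u')\}=\{e,e'\}$. This is a 2-crossed module, and $\mathrm{proj}=(\mathrm{id},(e,u)\mapsto e,p)\colon Q^1(\mathcal{A})\to\mathcal{A}$ is a map of 2-crossed modules. Lax homotopies. A lax homotopy connecting maps $f,f'\colon\mathcal{A}\to\mathcal{A}'$ is a homotopy $f\circ\mathrm{proj}\xrightarrow{(f\circ\mathrm{proj},s,t)}f'\circ\mathrm{proj}$ of maps $Q^1(\mathcal{A})\to\mathcal{A}'$. It is determined by, and denoted by, the quadruple $(f,\hat s,\hat t,\Pi)$ with $\hat s(g)=s([g])$, $\hat t(e)=t(e,[\partial(e)])$, $\Pi(g,h)=t(1,[gh]^{-1}[g][h])$ ($g,h\in G$, $e\in E$). *)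

(* Defs.v *)
From HB Require Import structures.
From mathcomp Require Import all_boot.

Set Implicit Arguments.
Unset Strict Implicit.
Unset Printing Implicit Defensive.

Import Algebra.
Local Open Scope group_scope.

Notation "{ 'gmorph' G -> H }" := (UMagmaMorphism.type G H)
  (at level 0, G at level 98, H at level 99, format "{ 'gmorph'  G  ->  H }")
  : type_scope.

Section FreeGroup.
Variable X : choiceType.

(* (x, false) stands for the letter [x], and (x, true) for [x]^-1. *)
Local Notation letter := (X * bool)%type.

Definition inv_letter (a : letter) : letter := (a.1, ~~ a.2).

Definition reduced : pred (seq letter) := sorted (fun a b => b != inv_letter a).

(* The free group on X, as the group of reduced words. *)
Record free_group := FreeGroup { fg_word :> seq letter; _ : reduced fg_word }.
HB.instance Definition _ := [isSub for fg_word].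
HB.instance Definition _ := [Choice of free_group by <:].

(* Reduced form of a :: w, for w reduced. *)
Definition cons_letter (a : letter) (w : seq letter) : seq letter :=
  if w is b :: w' then if b == inv_letter a then w' else a :: w else [:: a].

Definition mul_word (u v : seq letter) := foldr cons_letter v u.
Definition inv_word (u : seq letter) := rev (map inv_letter u).

Lemma inv_letterK : involutive inv_letter.
Proof. by case=> x b; rewrite /inv_letter /= negbK. Qed.

Lemma cons_letter_reduced a w : reduced w -> reduced (cons_letter a w).
Proof.
case: w => [//|b w] /=; case: ifPn => [_ /path_sorted //|ab rw].
by rewrite /reduced /= ab.
Qed.

Lemma mul_word_reduced u v : reduced v -> reduced (mul_word u v).
Proof. by move=> rv; elim: u => //= a u; apply: cons_letter_reduced. Qed.

Lemma inv_word_reduced u : reduced u -> reduced (inv_word u).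
Proof.
rewrite /reduced /inv_word rev_sorted sorted_map; apply: sub_sorted => a b /=.
by rewrite inv_letterK; apply: contraNneq => <-.
Qed.

Lemma cons_letterK a w :
  reduced w -> cons_letter a (cons_letter (inv_letter a) w) = w.
Proof.
case: w => [|b w] /=; first by rewrite eqxx.
rewrite inv_letterK; case: eqP => [-> |_ _]; last by rewrite /= eqxx.
by case: w => [//|c w] /= /andP[/negPf ->].
Qed.

Lemma mul_wordA u v w :
  reduced w -> mul_word u (mul_word v w) = mul_word (mul_word u v) w.
Proof.
move=> rw; elim: u => //= a u ->.
case: (mul_word u v) => [//|b x] /=; case: eqP => [-> /=|//].
by rewrite cons_letterK // mul_word_reduced.
Qed.

Lemma mul_word0 u : reduced u -> mul_word u [::] = u.
Proof.
elim: u => //= a [|b u] IH //= /andP[ab ru].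
by move: (IH ru) => /= -> /=; rewrite (negPf ab).
Qed.

Lemma mul_word_cat u v w : mul_word (u ++ v) w = mul_word u (mul_word v w).
Proof. by rewrite /mul_word foldr_cat. Qed.

Lemma inv_word_mul u v :
  reduced v -> mul_word (inv_word u) (mul_word u v) = v.
Proof.
elim: u v => //= a u IH v rv.
rewrite /inv_word /= rev_cons -cats1 mul_word_cat /=.
rewrite -[X in cons_letter _ (cons_letter X _)]inv_letterK cons_letterK.
  exact: IH.
exact: mul_word_reduced.
Qed.

Lemma inv_wordK : involutive inv_word.
Proof.
move=> u; rewrite /inv_word map_rev revK -map_comp.
by rewrite (eq_map inv_letterK) map_id.
Qed.

Definition fg_one := @FreeGroup [::] isT.
Definition fg_mul (u v : free_group) : free_group :=
  FreeGroup (mul_word_reduced u (valP v)).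
Definition fg_inv (u : free_group) : free_group :=
  FreeGroup (inv_word_reduced (valP u)).

Lemma fg_mulA : associative fg_mul.
Proof. by move=> u v w; apply/val_inj/mul_wordA/(valP w). Qed.
Lemma fg_mul1 : left_id fg_one fg_mul.
Proof. by move=> u; apply/val_inj. Qed.
Lemma fg_mulr1 : right_id fg_one fg_mul.
Proof. by move=> u; apply/val_inj/mul_word0/(valP u). Qed.
Lemma fg_mulV : left_inverse fg_one fg_inv fg_mul.
Proof.
move=> u; apply/val_inj => /=.
by rewrite -{2}[fg_word u](mul_word0 (valP u)) inv_word_mul.
Qed.
Lemma fg_mulVr : right_inverse fg_one fg_inv fg_mul.
Proof.
move=> u; have := fg_mulV (fg_inv u); congr (fg_mul _ _ = _).
by apply/val_inj/inv_wordK.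
Qed.

HB.instance Definition _ :=
  isGroup.Build free_group fg_mulA fg_mul1 fg_mulr1 fg_mulV fg_mulVr.

Definition fg_gen (x : X) : free_group := @FreeGroup [:: (x, false)] isT.

Section Lift.
Variables (H : groupType) (f : X -> H).

Definition eval_letter (a : letter) : H := if a.2 then (f a.1)^-1 else f a.1.
Definition fg_lift (u : free_group) : H := \prod_(a <- fg_word u) eval_letter a.

Lemma eval_inv_letter a : eval_letter (inv_letter a) = (eval_letter a)^-1.
Proof. by case: a => x [] //=; rewrite /eval_letter /= ?invgK. Qed.

Lemma fg_lift1 : fg_lift 1 = 1.
Proof. exact: big_nil. Qed.

Lemma fg_liftM : {morph fg_lift : u v / u * v}.
Proof.
move=> [u ru] [v rv]; rewrite /fg_lift /= {ru rv}.
elim: u => [|a u IH] /=; first by rewrite big_nil mul1g.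
rewrite big_cons -mulgA -IH.
case: (mul_word u v) => [|b w] /=; first by rewrite big_seq1 big_nil mulg1.
case: eqP => [-> |_]; last by rewrite big_cons.
by rewrite big_cons eval_inv_letter mulVKg.
Qed.

HB.instance Definition _ := isMultiplicative.Build free_group H fg_lift fg_liftM.
HB.instance Definition _ :=
  Multiplicative_isUMagmaMorphism.Build free_group H fg_lift fg_lift1.

Lemma fg_lift_gen x : fg_lift (fg_gen x) = f x.
Proof. exact: big_seq1. Qed.

End Lift.

Lemma fg_lift_unique (H : groupType) (m : {gmorph free_group -> H}) u :
  m u = fg_lift (fun x => m (fg_gen x)) u.
Proof.
case: u => u; elim: u => [|[x b] u IH] ru.
  by rewrite (_ : FreeGroup ru = 1) ?gmulf1 ?fg_lift1 //; apply/val_inj.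
have ru' : reduced u by exact: path_sorted ru.
pose a : free_group := if b then (fg_gen x)^-1 else fg_gen x.
have -> : FreeGroup ru = a * FreeGroup ru'.
  apply/val_inj; rewrite /a; case: b ru {a} => ru /=.
    by case: u ru ru' {IH} => [//|c u] /= /andP[/negPf -> ].
  by case: u ru ru' {IH} => [//|c u] /= /andP[/negPf -> ].
rewrite gmulfM fg_liftM IH /a; congr (_ * _).
by case: b {ru a} => /=; rewrite ?gmulfV /=; [congr (_^-1) |]; apply/esym/fg_lift_gen.
Qed.

End FreeGroup.

Definition is_aut_action (G H : groupType) (act : G -> H -> H) : Prop :=
  [/\ forall x, act 1 x = x,
      forall g h x, act (g * h) x = act g (act h x)
    & forall g, {morph act g : x y / x * y}].

(* The derived action e |>' l of E on L, in terms of delta and the lifting. *)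
Definition lifting_act (L E : groupType) (d : L -> E) (br : E -> E -> L)
  (e : E) (l : L) : L := l * br (d l)^-1 e.

Record xmod2 := Xmod2 {
  xL : groupType;
  xE : groupType;
  xG : groupType;
  xdelta : {gmorph xL -> xE};
  xbdry : {gmorph xE -> xG};
  xactL : xG -> xL -> xL;
  xactE : xG -> xE -> xE;
  xlift : xE -> xE -> xL;
  xcomplex : forall l, xbdry (xdelta l) = 1;
  xactL_action : is_aut_action xactL;
  xactE_action : is_aut_action xactE;
  xdelta_equiv : forall g l, xdelta (xactL g l) = xactE g (xdelta l);
  xbdry_equiv : forall g e, xbdry (xactE g e) = g * xbdry e * g^-1;
  xlift_equiv : forall g e f, xactL g (xlift e f) = xlift (xactE g e) (xactE g f);
  xdelta_lift : forall e f,
    xdelta (xlift e f) = e * f * e^-1 * xactE (xbdry e) f^-1;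
  xlift_delta : forall l k,
    l * k * l^-1 * k^-1 = xlift (xdelta l) (xdelta k);
  xlift_sym : forall l e,
    xlift (xdelta l) e * xlift e (xdelta l) = l * xactL (xbdry e) l^-1;
  xlift_mull : forall e f g,
    xlift (e * f) g = xlift e (f * g * f^-1) * xactL (xbdry e) (xlift f g);
  xlift_mulr : forall e f g,
    xlift e (f * g) =
      xlift e f * lifting_act xdelta xlift (xactE (xbdry e) f) (xlift e g)
}.

Arguments xdelta {x}.
Arguments xbdry {x}.

Definition xpact (A : xmod2) : xE A -> xL A -> xL A :=
  lifting_act xdelta (@xlift A).

Notation "g |>L l" := (xactL g l)
  (at level 35, right associativity) : group_scope.
Notation "g |>E e" := (xactE g e)
  (at level 35, right associativity) : group_scope.
Notation "e |>' l" := (xpact e l)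
  (at level 35, right associativity) : group_scope.
Notation "{{ e , f }}" := (xlift e f)
  (at level 0, e, f at level 99, format "{{ e ,  f }}") : group_scope.

Record xmod2_map (A B : xmod2) := Xmod2Map {
  mu : {gmorph xL A -> xL B};
  psi : {gmorph xE A -> xE B};
  phi : {gmorph xG A -> xG B};
  mu_delta : forall l, psi (xdelta l) = xdelta (mu l);
  psi_bdry : forall e, phi (xbdry e) = xbdry (psi e);
  mu_act : forall g l, mu (g |>L l) = phi g |>L mu l;
  psi_act : forall g e, psi (g |>E e) = phi g |>E psi e;
  mu_lift : forall e f, mu {{e, f}} = {{psi e, psi f}}
}.

Section MapComp.
Variables (A B C : xmod2) (g : xmod2_map B C) (f : xmod2_map A B).

Definition mu_comp : {gmorph xL A -> xL C} := mu g \o mu f.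
Definition psi_comp : {gmorph xE A -> xE C} := psi g \o psi f.
Definition phi_comp : {gmorph xG A -> xG C} := phi g \o phi f.

Definition xmod2_comp : xmod2_map A C.
Proof.
apply: (@Xmod2Map A C mu_comp psi_comp phi_comp) => /=.
- by move=> l; rewrite !mu_delta.
- by move=> e; rewrite !psi_bdry.
- by move=> x l; rewrite !mu_act.
- by move=> x e; rewrite !psi_act.
- by move=> e e'; rewrite !mu_lift.
Defined.

End MapComp.

Section Homotopy.
Variables C D : xmod2.

Definition derivation (ph : xG C -> xG D) (s : xG C -> xE D) : Prop :=
  forall g h, s (g * h) = ((ph h)^-1 |>E s g) * s h.

Definition quadratic_derivation (f : xmod2_map C D)
    (s : xG C -> xE D) (t : xE C -> xL D) : Prop :=
  [/\ derivation (phi f) s,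
      forall a b : xE C,
        t (a * b) =
          ((s (xbdry b))^-1 |>'
             ({{(psi f b)^-1, (s (xbdry a))^-1}}^-1
              * ((psi f b)^-1 |>' t a)))
          * t b
    & forall (g : xG C) (a : xE C),
        t (g |>E a) =
          (phi f g |>L
             ((s g * (s (xbdry a))^-1) |>' {{(psi f a)^-1, (s g)^-1}}^-1))
          * (phi f g |>L {{s g, (s (xbdry a))^-1 * (psi f a)^-1}})
          * ((phi f g * xbdry (s g)) |>L t a)].

(* A homotopy from f to f': the map determined by f and (hs, ht) is required to
   be f', so parallel homotopies between fixed maps form a type. *)
Record homotopy (f f' : xmod2_map C D) := Homotopy {
  hs : xG C -> xE D;
  ht : xE C -> xL D;
  homotopy_quad : quadratic_derivation f hs ht;
  homotopy_mu : forall l, mu f' l = mu f l * ht (xdelta l);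
  homotopy_psi : forall a, psi f' a = psi f a * hs (xbdry a) * xdelta (ht a);
  homotopy_phi : forall g, phi f' g = phi f g * xbdry (hs g)
}.

End Homotopy.

Section Resolution.
Variable A : xmod2.

Definition fg_proj : {gmorph free_group (xG A) -> xG A} := @fg_lift (xG A) (xG A) id.

Definition in_fibprod : pred (xE A * free_group (xG A)) :=
  fun x => xbdry x.1 == fg_proj x.2.

Record fibprod :=
  FibProd { fp_val :> xE A * free_group (xG A); _ : in_fibprod fp_val }.
HB.instance Definition _ := [isSub for fp_val].
HB.instance Definition _ := [Choice of fibprod by <:].

Lemma in_fibprod_closed : group_closed in_fibprod.
Proof.
split=> [|u v /eqP eu /eqP ev]; apply/eqP; first by rewrite !gmulf1.
by rewrite !gmulfF eu ev.
Qed.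
HB.instance Definition _ :=
  SubChoice_isSubGroup.Build _ in_fibprod fibprod in_fibprod_closed.

Definition fp_pair (e : xE A) (u : free_group (xG A))
  (eu : xbdry e = fg_proj u) : fibprod := FibProd (introT eqP eu : in_fibprod (e, u)).

Lemma fp_eq (x : fibprod) : xbdry x.1 = fg_proj x.2.
Proof. exact/eqP/(valP x). Qed.

Lemma fp_inj (x y : fibprod) : x.1 = y.1 -> x.2 = y.2 -> x = y.
Proof.
move=> e1 e2; apply/val_inj.
by rewrite [LHS]surjective_pairing e1 e2 -surjective_pairing.
Qed.

Fact q1_delta_subproof (l : xL A) : xbdry (xdelta l) = fg_proj 1.
Proof. by rewrite xcomplex gmulf1. Qed.
Definition q1_delta (l : xL A) : fibprod := fp_pair (q1_delta_subproof l).

Definition q1_bdry (x : fibprod) : free_group (xG A) := x.2.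

Definition q1_actL (u : free_group (xG A)) (l : xL A) : xL A := fg_proj u |>L l.

Fact q1_actE_subproof (u : free_group (xG A)) (x : fibprod) :
  xbdry (fg_proj u |>E x.1) = fg_proj (u * x.2 * u^-1).
Proof. by rewrite xbdry_equiv !gmulfM !gmulfV fp_eq. Qed.
Definition q1_actE (u : free_group (xG A)) (x : fibprod) : fibprod :=
  fp_pair (q1_actE_subproof u x).

Definition q1_lift (x y : fibprod) : xL A := {{x.1, y.1}}.

Fact q1_deltaM : {morph q1_delta : x y / x * y}.
Proof.
by move=> x y; apply/val_inj; rewrite valM; congr pair; rewrite /= ?gmulfM ?mulg1.
Qed.
Fact q1_delta1 : q1_delta 1 = 1.
Proof. by apply/val_inj; rewrite val1; congr pair; rewrite /= gmulf1. Qed.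
HB.instance Definition _ := isMultiplicative.Build (xL A) fibprod q1_delta q1_deltaM.
HB.instance Definition _ :=
  Multiplicative_isUMagmaMorphism.Build (xL A) fibprod q1_delta q1_delta1.

Fact q1_bdryM : {morph q1_bdry : x y / x * y}.
Proof. by []. Qed.
Fact q1_bdry1 : q1_bdry 1 = 1.
Proof. by []. Qed.
HB.instance Definition _ :=
  isMultiplicative.Build fibprod (free_group (xG A)) q1_bdry q1_bdryM.
HB.instance Definition _ :=
  Multiplicative_isUMagmaMorphism.Build fibprod (free_group (xG A)) q1_bdry q1_bdry1.

Fact q1_complex l : q1_bdry (q1_delta l) = 1.
Proof. by []. Qed.
Fact q1_actL_action : is_aut_action q1_actL.
Proof.
have [a1 aM aX] := xactL_action A; rewrite /q1_actL.
by split=> [x|g h x|g x y]; rewrite ?gmulf1 ?gmulfM ?a1 ?aM ?aX.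
Qed.
Fact q1_actE_action : is_aut_action q1_actE.
Proof.
have [a1 aM aX] := xactE_action A.
split=> [x|g h x|g x y]; apply: fp_inj => /=.
- by rewrite gmulf1 a1.
- by rewrite mul1g invg1 mulg1.
- by rewrite gmulfM aM.
- by rewrite invgM !mulgA.
- by rewrite aX.
- by rewrite !mulgA mulgVK.
Qed.
Fact q1_delta_equiv u l : q1_delta (q1_actL u l) = q1_actE u (q1_delta l).
Proof.
apply: fp_inj => /=; first by rewrite xdelta_equiv.
by rewrite mulg1 mulgV.
Qed.
Fact q1_bdry_equiv u x : q1_bdry (q1_actE u x) = u * q1_bdry x * u^-1.
Proof. by []. Qed.
Fact q1_lift_equiv u x y :
  q1_actL u (q1_lift x y) = q1_lift (q1_actE u x) (q1_actE u y).
Proof. exact: xlift_equiv. Qed.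
Fact q1_delta_lift x y :
  q1_delta (q1_lift x y) = x * y * x^-1 * q1_actE (q1_bdry x) y^-1.
Proof.
apply: fp_inj => /=; first by rewrite xdelta_lift fp_eq.
by rewrite /q1_bdry !mulgA mulgVK mulgK mulgV.
Qed.
Fact q1_lift_delta l k : l * k * l^-1 * k^-1 = q1_lift (q1_delta l) (q1_delta k).
Proof. exact: xlift_delta. Qed.
Fact q1_lift_sym l x :
  q1_lift (q1_delta l) x * q1_lift x (q1_delta l) = l * q1_actL (q1_bdry x) l^-1.
Proof. by rewrite /q1_actL /q1_bdry -fp_eq; apply: xlift_sym. Qed.
Fact q1_lift_mull x y z :
  q1_lift (x * y) z =
    q1_lift x (y * z * y^-1) * q1_actL (q1_bdry x) (q1_lift y z).
Proof. by rewrite /q1_actL /q1_bdry -fp_eq; apply: xlift_mull. Qed.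
Fact q1_lift_mulr x y z :
  q1_lift x (y * z) =
    q1_lift x y * lifting_act q1_delta q1_lift (q1_actE (q1_bdry x) y) (q1_lift x z).
Proof.
rewrite /q1_lift /lifting_act /= xlift_mulr /lifting_act fp_eq.
by [].
Qed.

Definition Q1 : xmod2 :=
  @Xmod2 (xL A) fibprod (free_group (xG A)) q1_delta q1_bdry
    q1_actL q1_actE q1_lift
    q1_complex q1_actL_action q1_actE_action q1_delta_equiv q1_bdry_equiv
    q1_lift_equiv q1_delta_lift q1_lift_delta q1_lift_sym q1_lift_mull
    q1_lift_mulr.

Definition q1_proj_E (x : fibprod) : xE A := x.1.
Fact q1_proj_EM : {morph q1_proj_E : x y / x * y}.
Proof. by []. Qed.
Fact q1_proj_E1 : q1_proj_E 1 = 1.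
Proof. by []. Qed.
HB.instance Definition _ :=
  isMultiplicative.Build fibprod (xE A) q1_proj_E q1_proj_EM.
HB.instance Definition _ :=
  Multiplicative_isUMagmaMorphism.Build fibprod (xE A) q1_proj_E q1_proj_E1.

Definition proj : xmod2_map Q1 A.
Proof.
apply: (@Xmod2Map Q1 A idfun q1_proj_E fg_proj) => //=.
by move=> x; rewrite -fp_eq.
Defined.

Fact fg_proj_gen (g : xG A) : fg_proj (fg_gen g) = g.
Proof. exact: fg_lift_gen. Qed.

(* (e, [bdry e]) *)
Fact q1_cell_subproof (e : xE A) : xbdry e = fg_proj (fg_gen (xbdry e)).
Proof. by rewrite fg_proj_gen. Qed.
Definition q1_cell (e : xE A) : fibprod := fp_pair (q1_cell_subproof e).

(* (1, [gh]^-1 [g] [h]) *)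
Fact q1_defect_subproof (g h : xG A) :
  xbdry (1 : xE A) = fg_proj ((fg_gen (g * h))^-1 * fg_gen g * fg_gen h).
Proof. by rewrite !gmulfM gmulfV !fg_proj_gen gmulf1 -mulgA mulVg. Qed.
Definition q1_defect (g h : xG A) : fibprod := fp_pair (q1_defect_subproof g h).

End Resolution.

Section Lax.
Variables A A' : xmod2.
Implicit Types f : xmod2_map A A'.

Definition lax_homotopy f f' : Type :=
  homotopy (xmod2_comp f (proj A)) (xmod2_comp f' (proj A)).

Definition hat_s f f' (h : lax_homotopy f f') (g : xG A) : xE A' :=
  hs h (fg_gen g).
Definition hat_t f f' (h : lax_homotopy f f') (e : xE A) : xL A' :=
  ht h (q1_cell e).
Definition hat_Pi f f' (h : lax_homotopy f f') (g k : xG A) : xL A' :=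
  ht h (q1_defect g k).

Definition Theta f f' (s s' : xG A -> xE A') (x y z : xG A) : xL A' :=
  ((s' z)^-1 |>' {{(s z)^-1, (phi f z)^-1 |>E (s' y)^-1}})
  * ((((phi f' z)^-1 |>E s' y) * s' z)^-1 |>'
       ({{(((phi f z)^-1 |>E s y) * s z)^-1,
          ((phi f (y * z))^-1 * phi f x) |>E (s x * s' x * (s x)^-1)}}
        * (((phi f' (y * z))^-1 * phi f x) |>L {{s x, s' x}}))).

Definition Xi f (s : xG A -> xE A') (k : xG A -> xL A') (x y z : xG A) : xL A' :=
  ((s z)^-1 |>'
     ((phi f z)^-1 |>L
        (((s y)^-1 |>' (((phi f y)^-1 * phi f x) |>L (s x |>' (k x)^-1)))
         * k y)))
  * k z.

Record lax_2homotopy f f' (h h' : lax_homotopy f f') := Lax2Homotopy {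
  hat_k :> xG A -> xL A';
  lax2_s : forall g, hat_s h' g = hat_s h g * xdelta (hat_k g);
  lax2_t : forall e, hat_t h' e = (hat_k (xbdry e))^-1 * hat_t h e;
  lax2_Pi : forall g k,
    hat_Pi h' g k = (Xi f (hat_s h) hat_k (g * k) g k)^-1 * hat_Pi h g k
}.

End Lax.

(* Cells are composed in diagrammatic order.  The associativity and unit laws
   of horizontal composition relate 2-cells whose boundaries are only
   propositionally equal; they are stated as equalities of the 2-cells packed
   with their boundaries. *)
Definition pack2 (M : Type) (N : M -> M -> Type) (a b : M) (n : N a b) :
  {ab : M * M & N ab.1 ab.2} := existT (fun ab => N ab.1 ab.2) (a, b) n.

Record strict_2groupoid (O : Type) (M : O -> O -> Type)
    (N : forall x y, M x y -> M x y -> Type) := Strict2Groupoid {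
  id1 : forall x, M x x;
  comp1 : forall x y z, M x y -> M y z -> M x z;
  id2 : forall x y (a : M x y), N x y a a;
  vcomp : forall x y (a b c : M x y), N x y a b -> N x y b c -> N x y a c;
  hcomp : forall x y z (a a' : M x y) (b b' : M y z),
    N x y a a' -> N y z b b' -> N x z (comp1 a b) (comp1 a' b');
  comp1A : forall x y z w (a : M x y) (b : M y z) (c : M z w),
    comp1 a (comp1 b c) = comp1 (comp1 a b) c;
  comp1_idl : forall x y (a : M x y), comp1 (id1 x) a = a;
  comp1_idr : forall x y (a : M x y), comp1 a (id1 y) = a;
  comp1_inv : forall x y (a : M x y),
    exists b : M y x, comp1 a b = id1 x /\ comp1 b a = id1 y;
  vcompA : forall x y (a b c d : M x y)
      (m : N x y a b) (n : N x y b c) (p : N x y c d),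
    vcomp m (vcomp n p) = vcomp (vcomp m n) p;
  vcomp_idl : forall x y (a b : M x y) (m : N x y a b), vcomp (id2 a) m = m;
  vcomp_idr : forall x y (a b : M x y) (m : N x y a b), vcomp m (id2 b) = m;
  vcomp_inv : forall x y (a b : M x y) (m : N x y a b),
    exists n : N x y b a, vcomp m n = id2 a /\ vcomp n m = id2 b;
  hcomp_id2 : forall x y z (a : M x y) (b : M y z),
    hcomp (id2 a) (id2 b) = id2 (comp1 a b);
  interchange : forall x y z (a a' a'' : M x y) (b b' b'' : M y z)
      (m : N x y a a') (m' : N x y a' a'') (n : N y z b b') (n' : N y z b' b''),
    hcomp (vcomp m m') (vcomp n n') = vcomp (hcomp m n) (hcomp m' n');
  hcompA : forall x y z w (a a' : M x y) (b b' : M y z) (c c' : M z w)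
      (m : N x y a a') (n : N y z b b') (p : N z w c c'),
    pack2 (hcomp m (hcomp n p)) = pack2 (hcomp (hcomp m n) p);
  hcomp_idl : forall x y (a a' : M x y) (m : N x y a a'),
    pack2 (hcomp (id2 (id1 x)) m) = pack2 m;
  hcomp_idr : forall x y (a a' : M x y) (m : N x y a a'),
    pack2 (hcomp m (id2 (id1 y))) = pack2 m
}.

Definition whisker_right (O : Type) (M : O -> O -> Type)
    (N : forall x y, M x y -> M x y -> Type) (C : strict_2groupoid N)
    (x y z : O) (a a' : M x y) (m : N x y a a') (b : M y z) :
  N x z (comp1 C a b) (comp1 C a' b) := hcomp C m (id2 C b).

Definition whisker_left (O : Type) (M : O -> O -> Type)
    (N : forall x y, M x y -> M x y -> Type) (C : strict_2groupoid N)
    (x y z : O) (b : M x y) (a a' : M y z) (m : N y z a a') :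
  N x z (comp1 C b a) (comp1 C b a') := hcomp C (id2 C b) m.

(* Main.v *)
(* A homotopy (s, t) out of f = (mu, psi, phi) is the same thing as a pair of
   group homomorphisms g |-> phi(g) s(g) and a |-> psi(a) s(bdry a) t(a), the
   second one equivariant, into the groups of a path object of the target: here
   e f l lives in E x| (E |x L), where e acts on E |x L by
   f |-> {e, f} (bdry e |> f) and l |-> e |>' l.  The whole quadratic derivation
   calculus thus becomes calculus in iterated semidirect products.

   Pointwise products s s' of derivations are not derivations, but only up to a
   2-cell: if u |-> phi(u) s(u) s'(u) w(u) is a homomorphism into
   (E x| (E |x L)) x| G, whose three faces are phi s, phi' s' and
   phi (s s' delta(w)), then the paths of two consecutive homotopies can be
   pasted along w into a new homotopy.  On the free group F(G) such a w exists
   and is unique once it is prescribed (trivial) on the basis; Theta is its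
   inverse at [gh]^-1 [g] [h].  Associativity, units and inverses follow from
   this uniqueness.

   A lax 2-fold homotopy out of h is a pasting of the identity homotopy with h
   along the extension of k to F(G): since E x_G F(G) is generated by the
   elements (e, [bdry e]) and (1, [gh]^-1 [g] [h]), the target is determined by
   h and k, so all the 2-dimensional structure reduces to identities between
   the functions k. *)
Require Import Defs.
From HB Require Import structures.
From mathcomp Require Import all_boot.
From Stdlib Require Import FunctionalExtensionality ProofIrrelevance.

Set Implicit Arguments.
Unset Strict Implicit.
Unset Printing Implicit Defensive.

Import Algebra.
Local Open Scope group_scope.

(** * Actions and semidirect products *)

Section ActionTheory.
Variables (G H : groupType) (act : G -> H -> H) (actP : is_aut_action act).

Lemma aut_act1 x : act 1 x = x. Proof. by case: actP. Qed.
Lemma aut_actA g h x : act g (act h x) = act (g * h) x.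
Proof. by case: actP => _ ->. Qed.
Lemma aut_actM g : {morph act g : x y / x * y}. Proof. by case: actP. Qed.
Lemma aut_act_one g : act g 1 = 1.
Proof. by apply: (mulgI (act g 1)); rewrite -aut_actM !mulg1. Qed.
Lemma aut_actV g x : act g x^-1 = (act g x)^-1.
Proof. by apply/esym/mulg1_eq; rewrite -aut_actM mulgV aut_act_one. Qed.
Lemma aut_actK g x : act g^-1 (act g x) = x.
Proof. by rewrite aut_actA mulVg aut_act1. Qed.
Lemma aut_actVK g x : act g (act g^-1 x) = x.
Proof. by rewrite aut_actA mulgV aut_act1. Qed.
End ActionTheory.

Section Semidirect.
Variables (H K : groupType) (act : H -> K -> K).

(* The pair (h, k) stands for the product h * k, where h * k * h^-1 = act h k. *)
Definition sdprod of is_aut_action act : Type := (H * K)%type.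

Variable actP : is_aut_action act.
Local Notation T := (sdprod actP).
HB.instance Definition _ := Choice.on T.

Definition sd_one : T := (1, 1).
Definition sd_mul (x y : T) : T := (x.1 * y.1, act y.1^-1 x.2 * y.2).
Definition sd_inv (x : T) : T := (x.1^-1, act x.1 x.2^-1).

Lemma sd_mulA : associative sd_mul.
Proof.
move=> [h k] [h' k'] [h'' k'']; rewrite /sd_mul /= mulgA; congr pair.
by rewrite (aut_actM actP) (aut_actA actP) invgM !mulgA.
Qed.
Lemma sd_mul1 : left_id sd_one sd_mul.
Proof. by case=> h k; rewrite /sd_mul /= (aut_act_one actP) !mul1g. Qed.
Lemma sd_mulr1 : right_id sd_one sd_mul.
Proof. by case=> h k; rewrite /sd_mul /= invg1 (aut_act1 actP) !mulg1. Qed.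
Lemma sd_mulV : left_inverse sd_one sd_inv sd_mul.
Proof. by case=> h k; rewrite /sd_mul /= (aut_actK actP) !mulVg. Qed.
Lemma sd_mulVr : right_inverse sd_one sd_inv sd_mul.
Proof. by case=> h k; rewrite /sd_mul /= invgK (aut_actV actP) !mulgV. Qed.

HB.instance Definition _ :=
  isGroup.Build T sd_mulA sd_mul1 sd_mulr1 sd_mulV sd_mulVr.

Lemma sdM (x y : T) : x * y = (x.1 * y.1, act y.1^-1 x.2 * y.2) :> T.
Proof. by []. Qed.
End Semidirect.

(** * Calculus in a 2-crossed module *)

(* A locked copy of the derived action: rewriting would otherwise match
   e |>' l as a product. *)
HB.lock Definition pact (A : xmod2) : xE A -> xL A -> xL A := @xpact A.
Notation "e |>* l" := (pact e l) (at level 35, right associativity) : group_scope.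

Lemma pactE (A : xmod2) (e : xE A) (l : xL A) : e |>' l = e |>* l.
Proof. by rewrite pact.unlock. Qed.

Section Calculus.
Variable D : xmod2.
Implicit Types (g : xG D) (e f h : xE D) (k l : xL D).

Definition gact1 := aut_act1 (xactL_action D).
Definition gactA := aut_actA (xactL_action D).
Definition gactM := aut_actM (xactL_action D).
Definition gact_one := aut_act_one (xactL_action D).
Definition gactV := aut_actV (xactL_action D).
Definition gacte1 := aut_act1 (xactE_action D).
Definition gacteA := aut_actA (xactE_action D).
Definition gacteM := aut_actM (xactE_action D).
Definition gacte_one := aut_act_one (xactE_action D).
Definition gacteV := aut_actV (xactE_action D).

Lemma deltaM l k : xdelta (l * k) = xdelta l * xdelta k :> xE D.
Proof. exact: gmulfM. Qed.
Lemma deltaV l : xdelta l^-1 = (xdelta l)^-1 :> xE D.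
Proof. exact: gmulfV. Qed.
Lemma delta1 : xdelta 1 = 1 :> xE D. Proof. exact: gmulf1. Qed.
Lemma bdryM e f : xbdry (e * f) = xbdry e * xbdry f :> xG D.
Proof. exact: gmulfM. Qed.
Lemma bdryV e : xbdry e^-1 = (xbdry e)^-1 :> xG D.
Proof. exact: gmulfV. Qed.
Lemma bdry1 : xbdry 1 = 1 :> xG D. Proof. exact: gmulf1. Qed.

Lemma lift1g e : {{1, e}} = 1.
Proof.
apply: (mulgI {{1, e}}); rewrite mulg1 -{3}[1]mul1g xlift_mull.
by rewrite bdry1 gact1 mul1g invg1 mulg1.
Qed.

Lemma liftg1 e : {{e, 1}} = 1.
Proof.
have := xlift_sym 1 e.
by rewrite delta1 lift1g invg1 gact_one !mul1g.
Qed.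

Lemma pact_def e l : e |>* l = l * {{(xdelta l)^-1, e}}.
Proof. by rewrite pact.unlock. Qed.

Lemma lift_mulr e f e' : {{e, f * e'}} = {{e, f}} * ((xbdry e |>E f) |>* {{e, e'}}).
Proof. by rewrite pact.unlock; apply: xlift_mulr. Qed.

Lemma lift_delta_l l e : {{xdelta l, e}} = l * (e |>* l^-1).
Proof. by rewrite pact_def deltaV invgK mulVKg. Qed.

Lemma pact_delta l k : xdelta l |>* k = l * k * l^-1.
Proof. by rewrite pact_def -deltaV -xlift_delta invgK !mulgA mulgV mul1g. Qed.

Lemma pact_g1 e : e |>* 1 = 1.
Proof. by rewrite pact_def delta1 invg1 lift1g mul1g. Qed.

Lemma pact1 l : 1 |>* l = l.
Proof. by rewrite pact_def liftg1 mulg1. Qed.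

Lemma delta_pact e l : xdelta (e |>* l) = e * xdelta l * e^-1.
Proof.
rewrite pact_def deltaM xdelta_lift -deltaV xcomplex gacte1 deltaV invgK.
by rewrite !mulgA mulgV mul1g.
Qed.

(** Expansion of [{{(xdelta l)^-1, e * f}}] in its second argument, where the boundary of [xdelta]
    is trivial. Once [pactM] is known it becomes the action law. *)
Lemma pactA_aux e f l :
  (e * f) |>* l = (e |>* l) * (e |>* (l^-1 * (f |>* l))).
Proof.
have := lift_mulr (xdelta l^-1) e f.
by rewrite xcomplex gacte1 !lift_delta_l invgK -mulgA => /mulgI.
Qed.

(* (d(m) e) |>' l is computed by pactA_aux; multiplicativity of e |>' - then
   follows by writing e d(l) as d(e |>' l) e. *)
Lemma pactM e : {morph pact e : l k / l * k}.
Proof.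
have pact_dm l f k : (xdelta l * f) |>* k = l * (f |>* k) * l^-1.
  by rewrite pactA_aux !pact_delta !gnorm.
move=> l k; rewrite [LHS]pact_def deltaM invgM xlift_mull -!deltaV xcomplex gact1.
rewrite lift_delta_l !invgK !mulgA mulgK -(mulgA _ e) pact_dm invgK !mulgA mulgV.
rewrite mul1g.
have -> : e * xdelta l = xdelta (e |>* l) * e by rewrite delta_pact mulgVK.
by rewrite -mulgA deltaV -pact_def pact_dm mulgVK.
Qed.

Lemma pactA e f l : e |>* f |>* l = (e * f) |>* l.
Proof. by rewrite pactA_aux -pactM mulVKg. Qed.

Lemma pact_action : is_aut_action (@pact D).
Proof. by split=> [l|e f l|e]; [exact: pact1|rewrite pactA|exact: pactM]. Qed.

Definition pactV := aut_actV pact_action.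
Definition pactK := aut_actK pact_action.
Definition pactVK := aut_actVK pact_action.

Lemma gact_pact g e l : g |>L (e |>* l) = (g |>E e) |>* (g |>L l).
Proof. by rewrite !pact_def gactM xlift_equiv gacteV xdelta_equiv. Qed.

Lemma gact_lift g e f : g |>L {{e, f}} = {{g |>E e, g |>E f}}.
Proof. exact: xlift_equiv. Qed.

Lemma lift_delta_r e l : {{e, xdelta l}} = (e |>* l) * (xbdry e |>L l^-1).
Proof.
apply: (mulgI {{xdelta l, e}}); rewrite xlift_sym lift_delta_l pactV.
by rewrite !mulgA mulgVK.
Qed.

Lemma delta_lift e f :
  xdelta {{e, f}} * (xbdry e |>E f) = e * f * e^-1.
Proof. by rewrite xdelta_lift gacteV mulgVK. Qed.

(** In [xlift_mull] the conjugate [f * h * f^-1] is rewritten by [delta_lift] and expanded. Now [e]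
    itself acts on [{{f, h}}], instead of its boundary. *)
Lemma lift_mull e f h :
  {{e * f, h}} = (e |>* {{f, h}}) * {{e, xbdry f |>E h}}.
Proof.
rewrite xlift_mull -(delta_lift f h) lift_mulr lift_delta_r.
rewrite -xdelta_equiv pact_delta -!mulgA; congr (_ * _).
by rewrite gactV !mulgA mulVg mul1g mulgVK.
Qed.

Lemma lift_invr e f :
  {{e, f^-1}} = (xbdry e |>E f)^-1 |>* {{e, f}}^-1.
Proof.
have := lift_mulr e f^-1 f; rewrite mulVg liftg1 gacteV => /esym/mulg1_eq.
by rewrite pactV => <-; rewrite invgK.
Qed.

Lemma lift_invl e f : {{e^-1, f}} = (e^-1 |>* {{e, xbdry e^-1 |>E f}}^-1).
Proof.
have := lift_mull e^-1 e (xbdry e^-1 |>E f); rewrite mulVg lift1g => /esym/mulg1_eq.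
by rewrite gacteA -bdryM mulgV bdry1 gacte1 pactV => ->.
Qed.

(* Both sides of delta_lift act in the same way on L. *)
Lemma lift_conj e f l :
  {{e, f}} * ((xbdry e |>E f) |>* l) * {{e, f}}^-1 = (e * f * e^-1) |>* l.
Proof. by rewrite -pact_delta pactA delta_lift. Qed.

End Calculus.

(** * The groups of the path object *)

Section Groups.
Variable D : xmod2.
Implicit Types (g : xG D) (e f s : xE D) (k l : xL D).

Lemma lift_delta_mul s l f :
  {{s, xdelta l * f}} = (s |>* l) * {{s, f}} * (xbdry s |>L l)^-1.
Proof.
by rewrite lift_mulr lift_delta_r -xdelta_equiv pact_delta gactV !gnorm.
Qed.

Lemma lift_conjC e f l :
  ((xbdry e |>E f) |>* l) * {{e, f}}^-1 =
  {{e, f}}^-1 * ((e * f * e^-1) |>* l).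
Proof. by rewrite -lift_conj !gnorm. Qed.

Lemma lift_invr_conj e f : {{e, f^-1}} = (e * f^-1 * e^-1) |>* {{e, f}}^-1.
Proof.
have -> : e * f^-1 * e^-1 = (e * f * e^-1)^-1 by rewrite !gnorm.
by rewrite -delta_lift invgM -pactA -deltaV pact_delta lift_invr !gnorm.
Qed.

(* 1-simplices of the simplicial group of D: an element g of G followed by s in
   E, with source g and target g * xbdry s. *)
Definition sourceG := sdprod (xactE_action D).
Definition sdEL := sdprod (pact_action D).

(** By [lift_invr], [{{e, x.1^-1}}^-1] is [{{e, x.1}}] moved to the right of [xbdry e |>E x.1], as
    the order of the pair demands. *)
Definition check_act e (x : sdEL) : sdEL :=
  (xbdry e |>E x.1, {{e, x.1^-1}}^-1 * (e |>* x.2)).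

(** The law in [e] is [lift_mull]; multiplicativity on pairs is [lift_mulr], corrected by
    [lift_conjC]. *)
Lemma check_actP : is_aut_action check_act.
Proof.
split=> [[f l]|e e' [f l]|e [f l] [f' l']]; rewrite /check_act /=.
- by rewrite bdry1 gacte1 lift1g invg1 mul1g pact1.
- by rewrite bdryM gacteA -gacteV lift_mull invgM -pactA pactM pactV mulgA.
- rewrite !sdM /= gacteM; congr pair.
  rewrite invgM lift_mulr !pactM pactV invgM !mulgA; congr (_ * _).
  rewrite -!mulgA !gacteV pactA; congr (_ * _).
  by rewrite -gacteV lift_conjC pactA !gnorm.
Qed.

(* Its element (e, (f, l)) is a path from e to e * f * delta l over the
   1-simplex (xbdry e, f). *)
Definition pathE := sdprod check_actP.

Lemma pathE_eq (x y : pathE) :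
  x.1 = y.1 -> x.2.1 = y.2.1 -> x.2.2 = y.2.2 -> x = y.
Proof. by case: x y => [e [f l]] [e' [f' l']] /= -> -> ->. Qed.

Definition pathE_act g (x : pathE) : pathE :=
  (g |>E x.1, (g |>E x.2.1, g |>L x.2.2)).

Lemma pathE_actP : is_aut_action pathE_act.
Proof.
split=> [[e [f l]]|g g' [e [f l]]|g [e [f l]] [e' [f' l']]]; rewrite /pathE_act /=.
- by rewrite !gacte1 gact1.
- by rewrite !gacteA gactA.
- apply: pathE_eq => /=; rewrite ?gacteM ?gactM ?gact_pact ?gacteV //.
    by rewrite -[in RHS]gacteV xbdry_equiv !gacteA !gnorm.
  by rewrite gactM gactV gact_lift !gact_pact !gacteV.
Qed.

(* 2-simplices: (g, (s, (s', w))) has faces (g, s), (g * xbdry s, s') and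
   (g, s * s' * delta w). *)
Definition simplexG := sdprod pathE_actP.

Definition unitsE := ((@invg1, @mulg1, @mul1g), (bdry1 D, gacte1, gact1, gacte_one),
  (gact_one, lift1g, liftg1, pact_g1, pact1)).

(** Embeddings of the three factors. They generate [pathE], so its identities become computations
    with words in these letters. *)
Definition kX e : pathE := (e, 1).
Definition kU f : pathE := (1, (f, 1)).
Definition kV l : pathE := (1, (1, l)).

Lemma kXM e f : kX (e * f) = kX e * kX f.
Proof. by apply: pathE_eq; rewrite /= ?unitsE. Qed.
Lemma kUM e f : kU (e * f) = kU e * kU f.
Proof. by apply: pathE_eq; rewrite /= ?unitsE. Qed.
Lemma kVM k l : kV (k * l) = kV k * kV l.
Proof. by apply: pathE_eq; rewrite /= ?unitsE. Qed.
Lemma kX1 : kX 1 = 1. Proof. by []. Qed.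
Lemma kU1 : kU 1 = 1. Proof. by []. Qed.
Lemma kV1 : kV 1 = 1. Proof. by []. Qed.
Lemma kXV e : kX e^-1 = (kX e)^-1.
Proof. by apply/esym/mulg1_eq; rewrite -kXM mulgV. Qed.
Lemma kUV e : kU e^-1 = (kU e)^-1.
Proof. by apply/esym/mulg1_eq; rewrite -kUM mulgV. Qed.
Lemma kVV l : kV l^-1 = (kV l)^-1.
Proof. by apply/esym/mulg1_eq; rewrite -kVM mulgV. Qed.

Lemma pathE_eta (x : pathE) : x = kX x.1 * kU x.2.1 * kV x.2.2.
Proof. by apply: pathE_eq; rewrite /= !unitsE. Qed.

Lemma kUkV f l : kU f * kV l = kV (f |>* l) * kU f.
Proof. by apply: pathE_eq; rewrite /= !unitsE // pactK. Qed.

Lemma kXkV e l : kX e * kV l = kV (e |>* l) * kX e.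
Proof. by apply: pathE_eq; rewrite /= !unitsE // pactK. Qed.

Lemma kXkU e f : kX e * kU f = kV {{e, f}} * kU (xbdry e |>E f) * kX e.
Proof.
apply: pathE_eq; rewrite /= !unitsE //.
  by rewrite gacteA -bdryM mulVg bdry1 gacte1.
rewrite lift_invl -gacteV gacteA -bdryM mulVg bdry1 gacte1 lift_invr.
by rewrite -gacteV !pactV !invgK gacteV mulVg.
Qed.

Lemma kinv : (forall e, (kX e)^-1 = kX e^-1) * (forall e, (kU e)^-1 = kU e^-1)
  * (forall l, (kV l)^-1 = kV l^-1).
Proof. by split; [split|] => ?; rewrite (kXV, kUV, kVV). Qed.

(** The versions with a prefix [x] apply inside words bracketed to the left. *)
Lemma kmerge :
  ((forall e f, kX e * kX f = kX (e * f))
   * (forall e f, kU e * kU f = kU (e * f))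
   * (forall k l, kV k * kV l = kV (k * l)))
  * ((forall x e f, x * kX e * kX f = x * kX (e * f))
     * (forall x e f, x * kU e * kU f = x * kU (e * f))
     * (forall x k l, x * kV k * kV l = x * kV (k * l)))
  * ((forall x e l, x * kX e * kV l = x * kV (e |>* l) * kX e)
     * (forall x e l, x * kU e * kV l = x * kV (e |>* l) * kU e)).
Proof.
by do ![split] => *; rewrite ?(kXM, kUM, kVM, mulgA) // -!mulgA (kXkV, kUkV).
Qed.

(* Collects all of L on the left of a word. *)
Definition knorm := ((@invgK pathE, @invgM pathE, kinv, @mulgA pathE),
  (kXkV, kUkV, kmerge), gnorm, (kX1, kU1, kV1)).

End Groups.

(* hat s is the action of s in E on paths.  It conjugates kU f as s would, up to
   a lifting; it acts on L by xbdry s, and on kX e * (kU e)^-1, which commutes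
   with L, by conjugation by kU s. *)
HB.lock Definition kZ (D : xmod2) (s e : xE D) : pathE D :=
  kU s * kX e * (kU (s * e))^-1.

HB.lock Definition hatU (D : xmod2) (s f : xE D) : pathE D :=
  kV {{s, f}}^-1 * kU (s * f * s^-1).

HB.lock Definition hatEL (D : xmod2) s (x : sdEL D) : pathE D :=
  hatU s x.1 * kV (xbdry s |>L x.2).

HB.lock Definition hat (D : xmod2) s (x : pathE D) : pathE D :=
  kZ s x.1 * hatU s x.1 * hatEL s x.2.

(** * The action of E on paths *)

Section Hat.
Variable D : xmod2.
Implicit Types (g : xG D) (e f s : xE D) (k l : xL D).
Local Notation pathE := (pathE D).
Local Notation sdEL := (sdEL D).

Lemma hatUE s f : hatU s f = kV {{s, f}}^-1 * kU (s * f * s^-1).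
Proof. by rewrite hatU.unlock. Qed.

Lemma kZE s e : kZ s e = kU s * kX e * (kU (s * e))^-1.
Proof. by rewrite kZ.unlock. Qed.

Lemma kZ1 s : kZ s 1 = 1.
Proof. by rewrite kZ.unlock kX1 !mulg1 mulgV. Qed.

(** [kX e] and [kU e] act on L in the same way, so the three factors of [kZ s e] act by [s], [e] and
    [(s * e)^-1], which cancel. *)
Lemma kZkV s e l : kZ s e * kV l = kV l * kZ s e.
Proof.
rewrite kZ.unlock -kUV -!mulgA kUkV !mulgA -(mulgA _ (kX e)) kXkV !mulgA kUkV.
by rewrite !pactA !gnorm pact1.
Qed.

Lemma hatUM s e f : hatU s (e * f) = hatU s e * hatU s f.
Proof.
rewrite hatU.unlock !knorm; congr (kV _ * kU _).
by rewrite lift_mulr invgM -pactV lift_conjC.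
Qed.

Lemma hatU1 s : hatU s 1 = 1.
Proof. by rewrite hatU.unlock liftg1 invg1 mulg1 mulgV kV1 mul1g. Qed.

Lemma hatUkV s f l :
  hatU s f * kV (xbdry s |>L l) = kV (xbdry s |>L (f |>* l)) * hatU s f.
Proof. by rewrite hatU.unlock !knorm gact_pact lift_conjC. Qed.

(** The image under [hat s] of the relation [kXkU], with the final factor [hatU s e] cancelled. *)
Lemma kZ_hatU s e f :
  kZ s e * hatU s (e * f * e^-1) =
  kV (xbdry s |>L {{e, f}}) * hatU s (xbdry e |>E f) * kZ s e.
Proof.
rewrite hatU.unlock mulgA kZkV.
have -> : kV {{s, e * f * e^-1}}^-1 * kZ s e * kU (s * (e * f * e^-1) * s^-1) =
  kV {{s, e * f * e^-1}}^-1 * (kU s * (kX e * kU f) * kX e^-1 * kU s^-1 * kZ s e).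
  by rewrite kZ.unlock !knorm.
rewrite kXkU kZ.unlock !knorm.
rewrite -!delta_lift lift_delta_mul !invgM invgK.
by rewrite !gnorm.
Qed.

(** The image under [hat s] of [kXM], with the final factor [hatU s f] cancelled. *)
Lemma kZM s e f : kZ s (e * f) * hatU s e = kZ s e * hatU s e * kZ s f.
Proof.
rewrite hatU.unlock !mulgA !kZkV -!mulgA; congr (_ * _).
by rewrite kZ.unlock !knorm.
Qed.

Lemma pathE_morph_eq (M : groupType) (p q : pathE -> M) :
    {morph p : x y / x * y} -> {morph q : x y / x * y} ->
    (forall e, p (kX e) = q (kX e)) -> (forall f, p (kU f) = q (kU f)) ->
    (forall l, p (kV l) = q (kV l)) ->
  p =1 q.
Proof.
by move=> pM qM eX eU eV x; rewrite (pathE_eta x) !pM !qM eX eU eV.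
Qed.

Lemma sdEL_eta (x : sdEL) : x = ((x.1, 1) : sdEL) * ((1, x.2) : sdEL).
Proof. by case: x => f l; rewrite sdM /= !unitsE. Qed.

Lemma hatELM s : {morph hatEL s : x y / x * y}.
Proof.
move=> [f l] [f' l']; rewrite hatEL.unlock /= hatUM gactM kVM !mulgA; congr (_ * _).
by rewrite -!mulgA hatUkV pactVK.
Qed.

(** Compatibility of [hat s] with the semidirect product structure, as needed for [hatM]. The two
    factors given by [sdEL_eta] are treated separately. *)
Lemma hatEL_check s e x :
  kZ s e * hatU s e * hatEL s x = hatEL s (check_act e x) * (kZ s e * hatU s e).
Proof.
rewrite (sdEL_eta x) (aut_actM (check_actP D)) !hatELM mulgA.
have -> : kZ s e * hatU s e * hatEL s (x.1, 1) =
    hatEL s (check_act e (x.1, 1)) * (kZ s e * hatU s e).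
  rewrite hatEL.unlock /= gact_one kV1 mulg1 pact_g1 mulg1 hatUkV.
  rewrite lift_invr -gacteV !pactV invgK pactA gacteV mulgV pact1.
  rewrite -!mulgA -hatUM.
  have -> : e * x.1 = e * x.1 * e^-1 * e by rewrite mulgVK.
  by rewrite hatUM (mulgA (kZ s e)) kZ_hatU !mulgA.
rewrite -!mulgA; congr (_ * _).
by rewrite hatEL.unlock /= gacte_one !unitsE hatU1 mul1g hatUkV !mulgA kZkV ?mul1g.
Qed.

Lemma hatM s : {morph hat s : x y / x * y}.
Proof.
move=> [e x] [e' x']; rewrite hat.unlock /= hatELM.
rewrite hatUM !mulgA kZM -!mulgA; congr (_ * (_ * _)).
rewrite !mulgA; congr (_ * _).
by rewrite hatEL_check (aut_actVK (check_actP D)) !mulgA.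
Qed.
Lemma hat_one s : hat s 1 = 1.
Proof. by apply: (mulgI (hat s 1)); rewrite -hatM !mulg1. Qed.
Lemma hatV s x : hat s x^-1 = (hat s x)^-1.
Proof. by apply/esym/mulg1_eq; rewrite -hatM mulgV hat_one. Qed.

(** The two factors are the images of [kX e * (kU e)^-1] and of [kU e]. *)
Lemma hat_kX s e : hat s (kX e) = kZ s e * hatU s e.
Proof. by rewrite hat.unlock hatEL.unlock /= hatU1 gact_one kV1 !mulg1. Qed.
Lemma hat_kU s f : hat s (kU f) = hatU s f.
Proof.
by rewrite hat.unlock hatEL.unlock /= kZ1 hatU1 gact_one kV1 !mulg1 !mul1g.
Qed.
Lemma hat_kV s l : hat s (kV l) = kV (xbdry s |>L l).
Proof. by rewrite hat.unlock hatEL.unlock /= kZ1 !hatU1 !mul1g. Qed.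

Lemma kUZ s s' e : kU s * kZ s' e = kZ (s * s') e * kU s.
Proof. by rewrite kZ.unlock !knorm. Qed.

Lemma hat_kZ s s' e : hat s (kZ s' e) = kZ (s * s') e.
Proof.
have -> : kZ s' e = kU s' * kX e * (kU (s' * e))^-1 by rewrite kZ.unlock.
rewrite !hatM hatV !hat_kU hat_kX hatUM invgM !mulgA mulgK.
apply: (mulIg (hatU s s')); rewrite mulgVK hatU.unlock.
by rewrite mulgA kZkV -!mulgA kUZ !mulgA mulgVK.
Qed.

Lemma hat_hatU s s' f : hat s (hatU s' f) = hatU (s * s') f.
Proof.
rewrite [hatU s' f]hatUE hatM hat_kU hat_kV hatU.unlock mulgA.
by rewrite !kmerge gactV -invgM -xlift_mull !gnorm.
Qed.

Lemma hatA s s' x : hat s (hat s' x) = hat (s * s') x.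
Proof.
move: x; apply: pathE_morph_eq.
- by move=> x y; rewrite !hatM.
- exact: hatM.
- by move=> e; rewrite !hat_kX hatM hat_kZ hat_hatU.
- by move=> f; rewrite !hat_kU hat_hatU.
- by move=> l; rewrite !hat_kV bdryM gactA.
Qed.

Lemma hat1 x : hat (1 : xE D) x = x.
Proof.
move: x; apply: (@pathE_morph_eq _ _ id) => [||e|f|l] //; first exact: hatM.
- by rewrite hat_kX kZE hatUE lift1g !unitsE ?mulgVK.
- by rewrite hat_kU hatUE lift1g !unitsE.
- by rewrite hat_kV bdry1 gact1.
Qed.

Lemma kUkX s e : kU s * kX e = kX e * (kV {{e^-1, s}} * kU (xbdry e^-1 |>E s)).
Proof.
apply: (mulgI (kX e^-1)); rewrite mulgA kXkU !mulgA -[RHS]mulgA.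
by rewrite !kmerge mulVg kX1 mul1g mulg1.
Qed.

(** The last coordinate is the formula for [t (g |>E a)] in a quadratic derivation, before [phi f g]
    acts. *)
Lemma hatE s (x : pathE) :
  hat s x =
    (x.1, ((xbdry x.1^-1 |>E s) * x.2.1 * s^-1,
           ((s * x.2.1^-1) |>* {{x.1^-1, s^-1}}^-1)
           * {{s, x.2.1^-1 * x.1^-1}} * (xbdry s |>L x.2.2))).
Proof.
case: x => e [f l]; rewrite [RHS]pathE_eta /= hat.unlock hatEL.unlock /=.
rewrite !mulgA -(mulgA (kZ _ _)) -hatUM kZE kUkX hatUE -!mulgA; congr (_ * _).
set q := xbdry _ |>E s; rewrite -invgM (lift_invr_conj s) (lift_invr e^-1) -/q.
by rewrite !knorm !pactM !pactV ?invgK !pactA !gnorm pact1.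
Qed.

Lemma pathE_act_kX g e : pathE_act g (kX e) = kX (g |>E e).
Proof. by apply: pathE_eq; rewrite /= ?unitsE. Qed.
Lemma pathE_act_kU g f : pathE_act g (kU f) = kU (g |>E f).
Proof. by apply: pathE_eq; rewrite /= ?unitsE. Qed.
Lemma pathE_act_kV g l : pathE_act g (kV l) = kV (g |>L l).
Proof. by apply: pathE_eq; rewrite /= ?unitsE. Qed.
Definition pathE_actM := aut_actM (pathE_actP D).
Definition pathE_actA := aut_actA (pathE_actP D).

(** This equivariance glues the actions of G and E on paths into one action of their semidirect
    product [sourceG]. *)
Lemma pathE_act_hat g s x :
  pathE_act g (hat s x) = hat (g |>E s) (pathE_act g x).
Proof.
move: x; apply: pathE_morph_eq.
- by move=> x y; rewrite hatM pathE_actM.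
- by move=> x y; rewrite pathE_actM hatM.
- move=> e; rewrite pathE_act_kX !hat_kX kZE hatUE.
  rewrite !pathE_actM -kUV !pathE_act_kU pathE_act_kX pathE_act_kV.
  by rewrite kZE hatUE gactV gact_lift !gacteM !gacteV -kUV gacteM.
- move=> f; rewrite pathE_act_kU !hat_kU !hatUE pathE_actM pathE_act_kU.
  by rewrite pathE_act_kV gactV gact_lift !gacteM !gacteV.
- move=> l; rewrite pathE_act_kV !hat_kV pathE_act_kV xbdry_equiv !gactA.
  by rewrite !gnorm.
Qed.

Definition path_act (z : sourceG D) (x : pathE) : pathE :=
  pathE_act z.1 (hat z.2 x).

Lemma path_actP : is_aut_action path_act.
Proof.
split=> [x|[g s] [h s'] x|[g s] x y]; rewrite /path_act /=.
- by rewrite hat1 (aut_act1 (pathE_actP D)).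
- by rewrite -hatA -pathE_actA (pathE_act_hat h) gacteA mulgV gacte1.
- by rewrite hatM pathE_actM.
Qed.

End Hat.

(** * Homotopies as homomorphisms *)

Section HomotopyAsMap.
Variables C D : xmod2.
Implicit Types (f : xmod2_map C D) (s : xG C -> xE D) (t : xE C -> xL D).

Definition src_map f s (g : xG C) : sourceG D := (phi f g, s g).
Definition path_map f s t (a : xE C) : pathE D := (psi f a, (s (xbdry a), t a)).

Lemma phiM f (g h : xG C) : phi f (g * h) = phi f g * phi f h.
Proof. exact: gmulfM. Qed.
Lemma phiV f (g : xG C) : phi f g^-1 = (phi f g)^-1.
Proof. exact: gmulfV. Qed.
Lemma phi1 f : phi f 1 = 1. Proof. exact: gmulf1. Qed.
Lemma psiM f (a b : xE C) : psi f (a * b) = psi f a * psi f b.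
Proof. exact: gmulfM. Qed.

Lemma derivation1 f s : derivation (phi f) s -> s 1 = 1.
Proof.
move=> ds; apply: (mulgI (s 1)).
by have := ds 1 1; rewrite phi1 invg1 gacte1 !mulg1.
Qed.

Lemma derivationV f s g : derivation (phi f) s -> s g^-1 = phi f g |>E (s g)^-1.
Proof.
move=> ds; have := ds g g^-1; rewrite mulgV (derivation1 ds) phiV invgK.
by move/esym/mulg1_eq => <-; rewrite gacteV.
Qed.

Lemma derivation_conj f s g (a : xE C) : derivation (phi f) s ->
  s (xbdry (g |>E a)) =
    phi f g |>E ((xbdry (psi f a)^-1 |>E s g) * s (xbdry a) * (s g)^-1).
Proof.
move=> ds; rewrite xbdry_equiv ds (derivationV _ ds) ds phiV invgK -gacteM.
by rewrite bdryV -psi_bdry.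
Qed.

Lemma derivationP f s : derivation (phi f) s <-> {morph src_map f s : g h / g * h}.
Proof.
split=> sM g h; first by rewrite /src_map sdM /= phiM sM.
exact: (congr1 (fun x : sourceG D => x.2) (sM g h)).
Qed.

(** Comparison of coordinates. The two laws of [t] are the last coordinates; the others follow from
    the derivation law of [s] and from [f] being a map. *)
Lemma quadratic_derivationP f s t :
  quadratic_derivation f s t <->
  [/\ {morph src_map f s : g h / g * h}, {morph path_map f s t : a b / a * b}
    & forall g a, path_map f s t (g |>E a) =
                  path_act (src_map f s g) (path_map f s t a)].
Proof.
split=> [[ds tM tact]|[/derivationP ds tM tact]]; split.
- exact/derivationP.
- move=> a b; apply: pathE_eq => /=; first exact: psiM.
    by rewrite bdryM ds bdryV -psi_bdry.
  by rewrite tM !pactE.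
- move=> g a; rewrite /path_act hatE; apply: pathE_eq => /=.
  + exact: psi_act.
  + exact: derivation_conj.
  by rewrite tact !pactE !gactM gactA.
- exact: ds.
- move=> a b; have := congr1 (fun x : pathE D => x.2.2) (tM a b).
  by rewrite !pactE.
- move=> g a; have := congr1 (fun x : pathE D => x.2.2) (tact g a).
  by rewrite /path_act hatE !pactE /= !gactM gactA.
Qed.

Variables f f' : xmod2_map C D.

Definition hsrc (h : homotopy f f') := src_map f (hs h).
Definition hpath (h : homotopy f f') := path_map f (hs h) (ht h).

Lemma hsrcM h : {morph hsrc h : x y / x * y}.
Proof. by have /quadratic_derivationP[] := homotopy_quad h. Qed.
Lemma hpathM h : {morph hpath h : x y / x * y}.
Proof. by have /quadratic_derivationP[] := homotopy_quad h. Qed.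
Lemma hpath_act h g a : hpath h (g |>E a) = path_act (hsrc h g) (hpath h a).
Proof. by have /quadratic_derivationP[_ _] := homotopy_quad h; apply. Qed.
Lemma hs_derivation (h : homotopy f f') : derivation (phi f) (hs h).
Proof. by case: (homotopy_quad h). Qed.

Lemma homotopy_eq (h h' : homotopy f f') :
  hs h =1 hs h' -> ht h =1 ht h' -> h = h'.
Proof.
case: h h' => [s t q m p o] [s' t' q' m' p' o'] /=.
move=> /functional_extensionality es /functional_extensionality et.
by subst s' t'; congr Homotopy; apply: proof_irrelevance.
Qed.

End HomotopyAsMap.

(** * Pasting of paths *)

Section Composition.
Variable D : xmod2.
Implicit Types (g : xG D) (e f s : xE D) (k l w : xL D).
Implicit Types (x y : pathE D) (z : simplexG D).

Definition deltaE := (@deltaM D, @deltaV D, @delta_pact D, @xdelta_lift D,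
  @xdelta_equiv D, (@gacteM D, @gacteV D), gnorm).

Definition pactN := (@pactM D, @pactV D, @pactA D, @pact1 D, gnorm).

Definition bdryE := (@bdryM D, @bdryV D, @xcomplex D, @gacteA D, @gactA D,
  @gacteV D, @gactV D, @gacte1 D, @gact1 D, gnorm).

Definition face0 z : sourceG D := (z.1, z.2.1).
Definition face1 z : sourceG D := (z.1 * xbdry z.2.1, z.2.2.1).
Definition face2 z : sourceG D := (z.1, z.2.1 * z.2.2.1 * xdelta z.2.2.2).

Lemma face0M : {morph face0 : z z' / z * z'}.
Proof. by []. Qed.

Lemma face1M : {morph face1 : z z' / z * z'}.
Proof.
move=> [g [s [s' w]]] [h [t [t' w']]]; rewrite /face1 [RHS]sdM /=.
congr (_, _); first by rewrite bdryM xbdry_equiv !gnorm.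
by rewrite gacteA bdryV invgM.
Qed.

Lemma face2M : {morph face2 : z z' / z * z'}.
Proof.
move=> [g [s [s' w]]] [h [t [t' w']]]; rewrite /face2 [RHS]sdM /=.
by rewrite !deltaE.
Qed.

(** Trades an action twisted by a boundary for conjugation by a lifting. This and its variants below
    bring both sides of an identity in L to the same word. *)
Lemma lift_expand e f k : (xbdry e |>E f) |>* k =
  {{e, f}}^-1 * ((e * f * e^-1) |>* k) * {{e, f}}.
Proof. by rewrite -lift_conj !gnorm. Qed.

Lemma lift_expandV e f k : (xbdry e |>E f)^-1 |>* k =
  {{e, f^-1}}^-1 * ((e * f^-1 * e^-1) |>* k) * {{e, f^-1}}.
Proof. by rewrite -gacteV lift_expand. Qed.

Lemma lift_expandVV e f k : ((xbdry e)^-1 |>E f)^-1 |>* k =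
  {{e^-1, f^-1}}^-1 * ((e^-1 * f^-1 * e) |>* k) * {{e^-1, f^-1}}.
Proof. by rewrite -bdryV lift_expandV invgK. Qed.

Lemma lift_expandVA e g f k : (((xbdry e)^-1 * g) |>E f)^-1 |>* k =
  {{e^-1, (g |>E f)^-1}}^-1 * ((e^-1 * (g |>E f)^-1 * e) |>* k)
  * {{e^-1, (g |>E f)^-1}}.
Proof. by rewrite -gacteA lift_expandVV. Qed.

Definition target x : xE D := x.1 * x.2.1 * xdelta x.2.2.
Definition path_bdry x : sourceG D := (xbdry x.1, x.2.1).

Lemma path_bdry_act (u : sourceG D) x :
  path_bdry (path_act u x) = u * path_bdry x * u^-1.
Proof.
case: u x => [g s] [e [f l]]; rewrite /path_act hatE /path_bdry !sdM /=.
by rewrite xbdry_equiv gacteM !invgK bdryV !gacteM !gacteV.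
Qed.

Lemma target_act (u : sourceG D) x :
  target (path_act u x) = (u.1 * xbdry u.2) |>E target x.
Proof.
case: u x => [g s] [e [f l]]; rewrite /path_act hatE /target /=.
rewrite -gacteA !xdelta_equiv -!gacteM; congr (_ |>E _).
by rewrite !deltaE.
Qed.

(* The concatenation of x and y along w: in pathE it is
   x * kU y.2.1 * kV y.2.2 * kV w^-1 * kU (delta w), where the last two factors
   together commute with L. *)
Definition paste x y w : pathE D :=
  (x.1, (x.2.1 * y.2.1 * xdelta w, w^-1 * (y.2.1^-1 |>* x.2.2) * y.2.2)).

Definition spine x y w : simplexG D := (xbdry x.1, (x.2.1, (y.2.1, w))).

(** Pasting is a homomorphism on pairs of composable paths, provided [w] is multiplied inside the
    2-simplices lying below. *)
Lemma pasteM x x' y y' w w' :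
  y.1 = target x -> y'.1 = target x' ->
  paste (x * x') (y * y') (spine x y w * spine x' y' w').2.2.2 =
  paste x y w * paste x' y' w'.
Proof.
move: x x' y y' => [e1 [f1 l1]] [e2 [f2 l2]] [_ [f1' l1']] [_ [f2' l2']] /= -> ->.
rewrite /target /=.
apply: pathE_eq => //=.
  by rewrite !deltaE !bdryE.
(* The coordinate in L: all liftings of products are expanded, then twisted actions are removed. *)
rewrite !invgM -!deltaV !lift_delta_mul !lift_mull !lift_delta_l !lift_mulr.
rewrite -?pactA !pact_delta !bdryE !pactN.
by rewrite -!pactA !lift_expandVA -!pactA !lift_expandVV -!pactA !pactN.
Qed.

Lemma spine_eq x y z : y.1 = target x -> face0 z = path_bdry x ->
  face1 z = path_bdry y -> z = spine x y z.2.2.2.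
Proof.
move: x y z => [e [f l]] [e' [f' l']] [g [s [s' w]]] /= -> [-> ->] [_ ->].
by [].
Qed.

(** Boundaries of paths are conjugated under the action, so the moved paths lie over the conjugate
    of the spine by [z]; this dictates the new [w]. *)
Definition paste_equivariant z := forall x y w, y.1 = target x ->
  paste (path_act (face0 z) x) (path_act (face1 z) y)
    (z * spine x y w * z^-1).2.2.2 = path_act (face2 z) (paste x y w).

Lemma face0V z : face0 z^-1 = (face0 z)^-1.
Proof. by apply/esym/mulg1_eq; rewrite -face0M mulgV. Qed.
Lemma face1V z : face1 z^-1 = (face1 z)^-1.
Proof.
by apply/esym/mulg1_eq; rewrite -face1M mulgV /face1 /= bdry1 mulg1.
Qed.

(** Reduces equivariance to the four factors in [simplexG_eta], for which it is a direct
    computation. *)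
Lemma paste_equivariantM z z' :
  paste_equivariant z -> paste_equivariant z' -> paste_equivariant (z * z').
Proof.
move=> Hz Hz' x y w exy.
rewrite face0M face1M face2M -!(aut_actA (path_actP D)) -Hz' // -Hz; last first.
  by rewrite target_act /path_act hatE /= exy.
(* The conjugate by [z'] of the spine is recognised as the spine of the moved paths. *)
rewrite -spine_eq; first by rewrite invgM !mulgA.
- by rewrite target_act /path_act hatE /= exy.
- by rewrite !face0M face0V path_bdry_act.
rewrite !face1M face1V path_bdry_act; congr (_ * _ * _).
by rewrite /face1 /path_bdry /= exy !bdryM xcomplex mulg1.
Qed.

Lemma simplexG_eta z : z =
  ((z.1, 1) : simplexG D) * ((1, kX z.2.1) : simplexG D)
  * ((1, kU z.2.2.1) : simplexG D) * ((1, kV z.2.2.2) : simplexG D).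
Proof.
case: z => g [s [s' w]]; rewrite !sdM /=.
congr (_, _); first by rewrite !mulg1.
by apply: pathE_eq; rewrite /= ?unitsE.
Qed.

Lemma paste_equivariant_base g : paste_equivariant (g, 1).
Proof.
move=> [e [f l]] [_ [f' l']] w /= ->.
rewrite /path_act /face0 /face1 /face2 /target /=.
apply: pathE_eq; rewrite /= ?hatE /= ?delta1 ?unitsE //.
- by rewrite !deltaE.
- by rewrite ?gactM ?gactV ?gact_pact ?gacteV invgK.
Qed.

Lemma paste_equivariant_kV k : paste_equivariant (1, kV k).
Proof.
move=> [e [f l]] [_ [f' l']] w /= ->.
rewrite /path_act /face0 /face1 /face2 /target /=.
apply: pathE_eq; rewrite /= ?hatE /= ?delta1 ?unitsE //.
- by rewrite !deltaE !bdryE.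
rewrite !invgM -!deltaV !lift_delta_l !lift_delta_r.
by rewrite -?pactA !pact_delta !bdryE !pactN.
Qed.

Lemma paste_equivariant_kX s : paste_equivariant (1, kX s).
Proof.
move=> [e [f l]] [_ [f' l']] w /= ->.
rewrite /path_act /face0 /face1 /face2 /target /=.
apply: pathE_eq; rewrite /= ?hatE /= ?delta1 ?unitsE //.
- by rewrite !deltaE !bdryE.
rewrite !invgM -!deltaV !lift_mulr ?lift_delta_r.
rewrite !gacteM -?xdelta_equiv -?pactA !pact_delta !gactM ?gact_pact !bdryE !pactN.
by rewrite -?pactA ?pact_delta !lift_expandV -?pactA !pactN.
Qed.

Lemma paste_equivariant_kU s : paste_equivariant (1, kU s).
Proof.
move=> [e [f l]] [_ [f' l']] w /= ->.
rewrite /path_act /face0 /face1 /face2 /target /=.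
apply: pathE_eq; rewrite /= ?hatE /= ?delta1 ?unitsE //.
- by rewrite !deltaE !bdryE.
rewrite !invgM -!deltaV !lift_mulr ?lift_delta_r !lift_mull !lift_delta_l.
rewrite !gacteM -?xdelta_equiv -?pactA !pact_delta !gactM ?gact_pact !bdryE !pactN.
by rewrite -?pactA ?pact_delta !lift_expandV -?pactA !pactN.
Qed.

Lemma paste_equivariant_all z : paste_equivariant z.
Proof.
rewrite (simplexG_eta z).
do !apply: paste_equivariantM.
- exact: paste_equivariant_base.
- exact: paste_equivariant_kX.
- exact: paste_equivariant_kU.
- exact: paste_equivariant_kV.
Qed.

End Composition.

Lemma paste_inj (D : xmod2) (x y y' : pathE D) w :
  y.1 = y'.1 -> paste x y w = paste x y' w -> y = y'.
Proof.
move=> e1 [/mulIg/mulgI e2 e3].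
by apply: pathE_eq => //; move: e3; rewrite e2 => /mulgI.
Qed.

(** * Pasting and unpasting of homotopies *)

Section Filler.
Variables C D : xmod2.
Implicit Types (f : xmod2_map C D).

Lemma morph_id_inv (G H : groupType) (m : G -> H) : {morph m : x y / x * y} ->
  m 1 = 1 /\ forall x, m x^-1 = (m x)^-1.
Proof.
move=> mM; have m1 : m 1 = 1 by apply: (mulgI (m 1)); rewrite -mM !mulg1.
by split=> // x; apply/esym/mulg1_eq; rewrite -mM mulgV.
Qed.

Lemma hpath1_target f f' (h : homotopy f f') a : psi f' a = target (hpath h a).
Proof. exact: homotopy_psi. Qed.

Section Paste.
Variables (f f' f'' : xmod2_map C D) (h : homotopy f f') (h' : homotopy f' f'').
Variable w : xG C -> xL D.

Definition filler (g : xG C) : simplexG D :=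
  (phi f g, (hs h g, (hs h' g, w g))).
Hypothesis fillerM : {morph filler : x y / x * y}.

Definition paste_s (g : xG C) : xE D := hs h g * hs h' g * xdelta (w g).
Definition paste_t (a : xE C) : xL D :=
  (w (xbdry a))^-1 * ((hs h' (xbdry a))^-1 |>* ht h a) * ht h' a.

Let w1 : w 1 = 1.
Proof.
exact: (congr1 (fun z : simplexG D => z.2.2.2) (morph_id_inv fillerM).1).
Qed.

Let pasteE' a : path_map f paste_s paste_t a =
  paste (hpath h a) (hpath h' a) (w (xbdry a)).
Proof. by []. Qed.

Let spineE a : spine (hpath h a) (hpath h' a) (w (xbdry a)) = filler (xbdry a).
Proof. by rewrite /spine /filler psi_bdry. Qed.

Let face1E g : face1 (filler g) = hsrc h' g.
Proof. by rewrite /face1 /hsrc /src_map (homotopy_phi h). Qed.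

(** The three conditions of [quadratic_derivationP] come from [face2M], [pasteM] and
    [paste_equivariant_all], since the spine at [a] is the filler at [xbdry a]. *)
Lemma paste_quad : quadratic_derivation f paste_s paste_t.
Proof.
apply/quadratic_derivationP; split.
- move=> g k; have := face2M (filler g) (filler k).
  by rewrite -fillerM.
- move=> a b; rewrite !pasteE' -pasteM; try exact: hpath1_target.
  by rewrite !hpathM !spineE -fillerM bdryM.
- move=> g a; rewrite !pasteE' !hpath_act.
  have := @paste_equivariant_all D (filler g) (hpath h a) (hpath h' a) (w (xbdry a)).
  move=> /(_ (hpath1_target h a)).
  rewrite spineE face1E -(morph_id_inv fillerM).2 -!fillerM -xbdry_equiv.
  by [].
Qed.

Lemma paste_mu l : mu f'' l = mu f l * paste_t (xdelta l).
Proof.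
rewrite (homotopy_mu h') (homotopy_mu h) /paste_t xcomplex w1.
by rewrite (derivation1 (hs_derivation h')) !invg1 pact1 mul1g mulgA.
Qed.

Lemma paste_psi a : psi f'' a = psi f a * paste_s (xbdry a) * xdelta (paste_t a).
Proof.
rewrite (homotopy_psi h') (homotopy_psi h) /paste_s /paste_t.
by rewrite !deltaE.
Qed.

Lemma paste_phi g : phi f'' g = phi f g * xbdry (paste_s g).
Proof.
by rewrite (homotopy_phi h') (homotopy_phi h) /paste_s !bdryM xcomplex mulg1 mulgA.
Qed.

Definition paste_homotopy : homotopy f f'' :=
  Homotopy paste_quad paste_mu paste_psi paste_phi.

End Paste.

Section Unpaste.
Variables (f f' f'' : xmod2_map C D) (h : homotopy f f') (h'' : homotopy f f'').
Variable s' : xG C -> xE D.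
Variable w : xG C -> xL D.

Let fil (g : xG C) : simplexG D := (phi f g, (hs h g, (s' g, w g))).
Hypothesis filM : {morph fil : x y / x * y}.
Hypothesis fil_s : forall g, hs h'' g = hs h g * s' g * xdelta (w g).

(** The solution for the second path of the equation that defines [paste_t]. *)
Definition unpaste_t (a : xE C) : xL D :=
  ((s' (xbdry a))^-1 |>* ht h a)^-1 * w (xbdry a) * ht h'' a.

Let w1 : w 1 = 1.
Proof.
exact: (congr1 (fun z : simplexG D => z.2.2.2) (morph_id_inv filM).1).
Qed.
Let s'1 : s' 1 = 1.
Proof.
exact: (congr1 (fun z : simplexG D => z.2.2.1) (morph_id_inv filM).1).
Qed.

Local Notation path' := (path_map f' s' unpaste_t).

Let pasteE' a : hpath h'' a = paste (hpath h a) (path' a) (w (xbdry a)).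
Proof.
rewrite /hpath /path_map /= fil_s; congr (_, (_, _)).
by rewrite /unpaste_t !gnorm.
Qed.

Let spineE a : spine (hpath h a) (path' a) (w (xbdry a)) = fil (xbdry a).
Proof. by rewrite /spine /fil psi_bdry. Qed.

Let face1E g : face1 (fil g) = src_map f' s' g.
Proof. by rewrite /face1 /src_map (homotopy_phi h). Qed.

(** The laws on paths hold after pasting with [h], because they hold for [h] and [h'']; [paste_inj]
    then cancels [h]. *)
Lemma unpaste_quad : quadratic_derivation f' s' unpaste_t.
Proof.
apply/quadratic_derivationP; split.
- by move=> g k; rewrite -!face1E -face1M -filM.
- move=> a b; apply: (@paste_inj _ (hpath h (a * b)) _ _ (w (xbdry (a * b)))).
    exact: psiM.
  rewrite -pasteE' !hpathM !pasteE' -pasteM; try exact: hpath1_target.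
  by rewrite !spineE -filM bdryM.
- move=> g a; apply: (@paste_inj _ (hpath h (g |>E a)) _ _ (w (xbdry (g |>E a)))).
    rewrite /path_act hatE /= psi_act.
    by rewrite (homotopy_phi h).
  rewrite -pasteE' !hpath_act pasteE'.
  have := @paste_equivariant_all D (fil g) (hpath h a) (path' a) (w (xbdry a)).
  move=> /(_ (hpath1_target h a)).
  rewrite spineE face1E -(morph_id_inv filM).2 -!filM -xbdry_equiv.
  by rewrite /hsrc /src_map fil_s.
Qed.

Lemma unpaste_mu l : mu f'' l = mu f' l * unpaste_t (xdelta l).
Proof.
rewrite (homotopy_mu h'') (homotopy_mu h) /unpaste_t xcomplex w1 s'1.
by rewrite !invg1 pact1 !gnorm.
Qed.

Lemma unpaste_psi a : psi f'' a = psi f' a * s' (xbdry a) * xdelta (unpaste_t a).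
Proof.
rewrite (homotopy_psi h'') (homotopy_psi h) fil_s /unpaste_t.
by rewrite !deltaE.
Qed.

Lemma unpaste_phi g : phi f'' g = phi f' g * xbdry (s' g).
Proof.
by rewrite (homotopy_phi h'') (homotopy_phi h) fil_s !bdryM xcomplex mulg1 mulgA.
Qed.

Definition unpaste_homotopy : homotopy f' f'' :=
  Homotopy unpaste_quad unpaste_mu unpaste_psi unpaste_phi.

End Unpaste.
End Filler.

(** * Composition over the free group *)

Section FreeGroupMorphisms.
Variables (X : choiceType) (H : groupType).

Lemma fg_morph_lift (m : free_group X -> H) : {morph m : x y / x * y} ->
  m =1 fg_lift (fun x => m (fg_gen x)).
Proof.
move=> mM; have [m1 _] := morph_id_inv mM.
pose M : {gmorph free_group X -> H} := HB.pack m
  (isMultiplicative.Build _ _ m mM)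
  (Multiplicative_isUMagmaMorphism.Build _ _ m m1).
exact: (fg_lift_unique M).
Qed.

Lemma fg_morph_eq (m m' : free_group X -> H) :
    {morph m : x y / x * y} -> {morph m' : x y / x * y} ->
    (forall x, m (fg_gen x) = m' (fg_gen x)) ->
  m =1 m'.
Proof.
move=> mM m'M e u; rewrite (fg_morph_lift mM) (fg_morph_lift m'M) /fg_lift.
by apply: eq_bigr => a _; rewrite /eval_letter e.
Qed.

End FreeGroupMorphisms.

Section FreeComposition.
Variables A D : xmod2.
Local Notation C := (Q1 A).
Local Notation F := (free_group (xG A)).
Implicit Types (f : xmod2_map C D) (u v : F).

Definition gfill f f' f'' (h : homotopy f f') (h' : homotopy f' f'') :
    F -> simplexG D :=
  fg_lift (fun x => (phi f (fg_gen x), (hs h (fg_gen x), (hs h' (fg_gen x), 1)))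
             : simplexG D).

Definition gfill_w f f' f'' (h : homotopy f f') (h' : homotopy f' f'') u :=
  (gfill h h' u).2.2.2.

Lemma gfillM f f' f'' (h : homotopy f f') (h' : homotopy f' f'') :
  {morph gfill h h' : u v / u * v}.
Proof. exact: fg_liftM. Qed.

(** The first two faces agree with [h] and [h'] on the basis, hence everywhere; only the coordinate
    in L is new. *)
Lemma gfillE f f' f'' (h : homotopy f f') (h' : homotopy f' f'') u :
  gfill h h' u = filler h h' (gfill_w h h') u.
Proof.
have e0 : face0 (gfill h h' u) = hsrc h u.
  apply: (fg_morph_eq (m := fun v => face0 (gfill h h' v))) => [x y||x].
  - by rewrite gfillM.
  - exact: (hsrcM h).
  - by rewrite /gfill fg_lift_gen.
have e1 : face1 (gfill h h' u) = hsrc h' u.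
  apply: (fg_morph_eq (m := fun v => face1 (gfill h h' v))) => [x y||x].
  - by rewrite gfillM face1M.
  - exact: (hsrcM h').
  - by rewrite /gfill fg_lift_gen /face1 /= /hsrc /src_map (homotopy_phi h).
rewrite /filler /gfill_w; move: e0 e1.
by case: (gfill h h' u) => [g [s [s' w]]] [-> ->] [_ ->].
Qed.

Lemma gfill_fillerM f f' f'' (h : homotopy f f') (h' : homotopy f' f'') :
  {morph filler h h' (gfill_w h h') : u v / u * v}.
Proof. by move=> u v; rewrite -!gfillE gfillM. Qed.

Lemma gfill_w_gen f f' f'' (h : homotopy f f') (h' : homotopy f' f'') x :
  gfill_w h h' (fg_gen x) = 1.
Proof. by rewrite /gfill_w /gfill fg_lift_gen. Qed.

Definition hcomp1 f f' f'' (h : homotopy f f') (h' : homotopy f' f'') :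
  homotopy f f'' := paste_homotopy (gfill_fillerM h h').

Lemma hs_hcomp1 f f' f'' (h : homotopy f f') (h' : homotopy f' f'') u :
  hs (hcomp1 h h') u = hs h u * hs h' u * xdelta (gfill_w h h' u).
Proof. by []. Qed.

Lemma hs_hcomp1_gen f f' f'' (h : homotopy f f') (h' : homotopy f' f'') x :
  hs (hcomp1 h h') (fg_gen x) = hs h (fg_gen x) * hs h' (fg_gen x).
Proof. by rewrite hs_hcomp1 gfill_w_gen delta1 mulg1. Qed.

Lemma ht_hcomp1 f f' f'' (h : homotopy f f') (h' : homotopy f' f'') a :
  ht (hcomp1 h h') a = (gfill_w h h' (xbdry a))^-1 *
    ((hs h' (xbdry a))^-1 |>* ht h a) * ht h' a.
Proof. by []. Qed.

Lemma hs_eq f f' f'' (h : homotopy f f') (h' : homotopy f f'') :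
  (forall x, hs h (fg_gen x) = hs h' (fg_gen x)) -> hs h =1 hs h'.
Proof.
move=> e u; suff: hsrc h u = hsrc h' u by case.
apply: fg_morph_eq => [||x]; [exact: (hsrcM h)|exact: (hsrcM h')|].
by rewrite /hsrc /src_map e.
Qed.

Lemma gfill_wM f f' f'' (h : homotopy f f') (h' : homotopy f' f'') u v :
  gfill_w h h' (u * v) =
    ((hs h' v)^-1 |>* ({{(hs h v)^-1, (phi f v)^-1 |>E (hs h' u)^-1}}^-1
                       * ((hs h v)^-1 |>* (phi f v)^-1 |>L gfill_w h h' u)))
    * gfill_w h h' v.
Proof.
have := congr1 (fun z : simplexG D => z.2.2.2) (gfill_fillerM h h' u v).
by rewrite /= gacteV.
Qed.

(** The law imposed on [w] says exactly that the filler with [w] is a homomorphism. *)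
Lemma gfill_w_unique f f' f'' (h : homotopy f f') (h' : homotopy f' f'')
    (w : F -> xL D) :
    (forall u v, w (u * v) =
      ((hs h' v)^-1 |>* ({{(hs h v)^-1, (phi f v)^-1 |>E (hs h' u)^-1}}^-1
                       * ((hs h v)^-1 |>* (phi f v)^-1 |>L w u))) * w v) ->
    (forall x, w (fg_gen x) = 1) ->
  w =1 gfill_w h h'.
Proof.
move=> wM w1 u.
suff e : filler h h' w u = filler h h' (gfill_w h h') u.
  exact: (congr1 (fun z : simplexG D => z.2.2.2) e).
apply: fg_morph_eq => [x y||x].
- have := gfill_fillerM h h' x y; rewrite /filler !sdM => -[-> -> -> _].
  by rewrite wM /= gacteV.
- exact: gfill_fillerM.
- by rewrite /filler w1 gfill_w_gen.
Qed.

Lemma id_quad f : quadratic_derivation f (fun _ : F => 1) (fun _ : xE C => 1 : xL D).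
Proof.
split=> [u v|a b|u a].
- by rewrite gacte_one mulg1.
- by rewrite !pactE invg1 liftg1 invg1 !pact_g1 !mulg1 pact_g1.
- rewrite !pactE !invg1 liftg1 invg1 pact_g1 lift1g !gact_one.
  by rewrite !mulg1.
Qed.

Definition hid f : homotopy f f.
Proof.
refine (@Homotopy C D f f (fun _ => 1) (fun _ => 1) (id_quad f) _ _ _).
- by move=> l; rewrite mulg1.
- by move=> a; rewrite delta1 !mulg1.
- by move=> g; rewrite bdry1 mulg1.
Defined.

Lemma hcomp1_idl f f' (h : homotopy f f') : hcomp1 (hid f) h = h.
Proof.
have w1 : (fun _ => 1) =1 gfill_w (hid f) h.
  apply: gfill_w_unique => // u v.
  by rewrite /= invg1 lift1g gact_one !pact_g1 invg1 !mulg1 pact_g1.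
apply: homotopy_eq => [u|a].
  by rewrite hs_hcomp1 -w1 delta1 mulg1 mul1g.
by rewrite ht_hcomp1 -w1 pact_g1 invg1 !mul1g.
Qed.

Lemma hcomp1_idr f f' (h : homotopy f f') : hcomp1 h (hid f') = h.
Proof.
have w1 : (fun _ => 1) =1 gfill_w h (hid f').
  apply: gfill_w_unique => // u v.
  by rewrite /= invg1 gacte_one liftg1 gact_one !pact_g1 invg1 !mulg1 pact_g1.
apply: homotopy_eq => [u|a].
  by rewrite hs_hcomp1 -w1 delta1 !mulg1.
by rewrite ht_hcomp1 -w1 !invg1 pact1 mul1g mulg1.
Qed.

Lemma hs_gM f f' (h : homotopy f f') u v :
  hs h (u * v) = ((phi f v)^-1 |>E hs h u) * hs h v.
Proof. exact: (hs_derivation h). Qed.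

Lemma phi_homotopyV f f' (h : homotopy f f') u :
  (phi f' u)^-1 = xbdry (hs h u)^-1 * (phi f u)^-1.
Proof. by rewrite (homotopy_phi h) invgM bdryV. Qed.

(** The fillers on the four faces of a 3-simplex with edges [a], [b], [c]. Solved for the filler of
    [hcomp1 a b] and [c], the relation is an instance of uniqueness. *)
Lemma gfill_w_cocycle f1 f2 f3 f4 (a : homotopy f1 f2) (b : homotopy f2 f3)
    (c : homotopy f3 f4) u :
  ((hs c u)^-1 |>* gfill_w a b u) * gfill_w (hcomp1 a b) c u =
  gfill_w b c u * gfill_w a (hcomp1 b c) u.
Proof.
suff <- : ((hs c u)^-1 |>* gfill_w a b u)^-1 *
    (gfill_w b c u * gfill_w a (hcomp1 b c) u) = gfill_w (hcomp1 a b) c u.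
  by rewrite !gnorm.
move: u; apply: gfill_w_unique => [u v|x]; last first.
  by rewrite !gfill_w_gen pact_g1 invg1 !mul1g.
rewrite !gfill_wM !hs_hcomp1 !(phi_homotopyV a) !hs_gM.
rewrite !(phi_homotopyV b) !(phi_homotopyV a).
rewrite -!gacteA -!gactA.
(* Only an identity between arbitrary elements of [D] remains. *)
move: (gfill_w a b u) (gfill_w b c u) (gfill_w a (hcomp1 b c) u).
move: (gfill_w a b v) (gfill_w b c v) (gfill_w a (hcomp1 b c) v).
move: (hs a u) (hs b u) (hs c u) (hs a v) (hs b v) (hs c v) (phi f1 v)^-1.
move=> {}a {}b {}c a' b' c' g.
move=> w0 w1 w2 w3 w4 w5.
rewrite !invgM -!deltaV !(gacteM, gacteV, gactM, gactV, gact_pact).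
rewrite -!xdelta_equiv ?gactV.
move: (g |>E b) (g |>E c) (g |>L w3) (g |>L w4) (g |>L w5).
move=> {}b {}c {}w3 {}w4 {}w5.
rewrite !lift_delta_mul !lift_mull !lift_delta_l !lift_mulr.
rewrite -?pactA !pact_delta !bdryE !pactN.
by rewrite -!pactA !lift_expandVA -!pactA !lift_expandVV -!pactA !pactN.
Qed.

Lemma hcomp1A f1 f2 f3 f4 (a : homotopy f1 f2) (b : homotopy f2 f3)
    (c : homotopy f3 f4) :
  hcomp1 a (hcomp1 b c) = hcomp1 (hcomp1 a b) c.
Proof.
apply: homotopy_eq => [|e].
  by apply: hs_eq => x; rewrite !hs_hcomp1_gen mulgA.
rewrite !ht_hcomp1 !hs_hcomp1; set u := xbdry e.
have /(canRL (mulKg _)) -> := gfill_w_cocycle a b c u.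
by rewrite !invgM -!deltaV -!pactA !pact_delta !pactN.
Qed.

(** [W] is prescribed on the basis with second edge inverse to the first, so its composite face is
    that of [hid f]. Unpasting [hid f] along [W] gives the inverse. *)
Lemma hcomp1_inv f f' (h : homotopy f f') :
  exists h' : homotopy f' f, hcomp1 h h' = hid f.
Proof.
pose W : F -> simplexG D := fg_lift (fun x =>
  (phi f (fg_gen x), (hs h (fg_gen x), ((hs h (fg_gen x))^-1, 1))) : simplexG D).
have WM : {morph W : u v / u * v} by exact: fg_liftM.
have WE u : W u = (phi f u, (hs h u, ((W u).2.2.1, (W u).2.2.2))).
  have : face0 (W u) = hsrc h u.
    apply: (fg_morph_eq (m := fun v => face0 (W v))) => [x y||x].
    - by rewrite WM.
    - exact: (hsrcM h).
    - by rewrite /W fg_lift_gen.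
  by case: (W u) => [g [s [s' w]]] [-> ->].
have W2 u : hs (hid f) u = hs h u * (W u).2.2.1 * xdelta (W u).2.2.2.
  have : face2 (W u) = hsrc (hid f) u.
    apply: (fg_morph_eq (m := fun v => face2 (W v))) => [x y||x].
    - by rewrite WM face2M.
    - exact: (hsrcM (hid f)).
    - by rewrite /W fg_lift_gen /face2 /= delta1 mulg1 mulgV.
  by rewrite WE => -[].
have filM : {morph (fun u =>
    (phi f u, (hs h u, ((W u).2.2.1, (W u).2.2.2))) : simplexG D) : u v / u * v}.
  by move=> u v; rewrite -!WE WM.
pose h' := @unpaste_homotopy C D f f' f h (hid f) (fun u => (W u).2.2.1)
  (fun u => (W u).2.2.2) filM W2.
exists h'.
(* [W] is trivial in L on the basis, so pasting along it is the composition [hcomp1]. *)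
have w1 : (fun u => (W u).2.2.2) =1 gfill_w h h'.
  apply: gfill_w_unique => [u v|x]; last by rewrite /W fg_lift_gen.
  have := congr1 (fun z : simplexG D => z.2.2.2) (filM u v).
  by rewrite /= gacteV.
apply: homotopy_eq => [u|a].
  by rewrite hs_hcomp1 -w1 W2.
rewrite ht_hcomp1 -w1 /= /unpaste_t /= mulg1.
by rewrite -mulgA mulgA !gnorm.
Qed.

Lemma hcomp1_inv2 f f' (h : homotopy f f') :
  exists h' : homotopy f' f, hcomp1 h h' = hid f /\ hcomp1 h' h = hid f'.
Proof.
have [h' hh'] := hcomp1_inv h; exists h'; split=> //.
have [h'' h'h''] := hcomp1_inv h'.
suff -> : h = h'' by [].
by rewrite -(hcomp1_idr h) -h'h'' hcomp1A hh' hcomp1_idl.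
Qed.

End FreeComposition.

(** * Generators of free groups and of the fibre product *)

Lemma free_group_ind (X : choiceType) (P : free_group X -> Prop) :
  P 1 -> (forall x u, P u -> P (fg_gen x * u)) ->
  (forall x u, P u -> P ((fg_gen x)^-1 * u)) -> forall u, P u.
Proof.
move=> P1 Pg Pv [u]; elim: u => [|[x b] u IH] ru.
  by rewrite (_ : FreeGroup ru = 1) //; apply/val_inj.
have ru' : reduced u by exact: path_sorted ru.
pose a : free_group X := if b then (fg_gen x)^-1 else fg_gen x.
have -> : FreeGroup ru = a * FreeGroup ru'.
  apply/val_inj; rewrite /a; case: b ru {a} => ru /=;
    by case: u ru ru' {IH} => [//|c u] /= /andP[/negPf -> ].
by rewrite /a; case: b {ru a}; [apply: Pv|apply: Pg]; apply: IH.
Qed.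

Section Generation.
Variable A : xmod2.

(* (1, [p(v)]^-1 v) *)
Fact fg_gap_subproof (v : free_group (xG A)) :
  xbdry (1 : xE A) = fg_proj A ((fg_gen (fg_proj A v))^-1 * v).
Proof. by rewrite gmulfM gmulfV fg_proj_gen gmulf1 mulVg. Qed.
Definition fg_gap v : fibprod A := fp_pair (fg_gap_subproof v).

(** Each [x] is [q1_cell x.1 * fg_gap x.2], and induction on words makes every gap a product of
    defects and their inverses. *)
Lemma fibprod_morph_eq (H : groupType) (m m' : fibprod A -> H) :
    {morph m : x y / x * y} -> {morph m' : x y / x * y} ->
    (forall e, m (q1_cell e) = m' (q1_cell e)) ->
    (forall g k, m (q1_defect g k) = m' (q1_defect g k)) ->
  m =1 m'.
Proof.
move=> mM m'M mc md.
have [m1 mV] := morph_id_inv mM; have [m'1 m'V] := morph_id_inv m'M.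
have gap v : m (fg_gap v) = m' (fg_gap v).
  elim/free_group_ind: v => [|g v IH|g v IH].
  (* [[1]] is a basis element, so this gap is [[1]^-1] rather than the unit. *)
  - have -> : fg_gap 1 = (q1_defect 1 1)^-1.
      apply: fp_inj => /=; first by rewrite invg1.
      by rewrite gmulf1 !mulg1 mulVg mul1g.
    by rewrite mV m'V md.
  - have -> : fg_gap (fg_gen g * v) = q1_defect g (fg_proj A v) * fg_gap v.
      apply: fp_inj => /=; first by rewrite mulg1.
      by rewrite gmulfM fg_proj_gen !gnorm.
    by rewrite mM m'M md IH.
  (* The second index is chosen so that the leading letter of the defect is [[p(v)]]. *)
  have -> : fg_gap ((fg_gen g)^-1 * v) =
      (q1_defect g (g^-1 * fg_proj A v))^-1 * fg_gap v.
    apply: fp_inj => /=; first by rewrite invg1 mulg1.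
    by rewrite gmulfM gmulfV fg_proj_gen mulVKg !gnorm.
  by rewrite mM m'M mV m'V md IH.
move=> x.
have -> : x = q1_cell x.1 * fg_gap x.2.
  apply: fp_inj => /=; first by rewrite mulg1.
  by rewrite fp_eq mulVKg.
by rewrite mM m'M mc gap.
Qed.

End Generation.


(** * 2-fold homotopies *)

Section Twist.
Variables A D : xmod2.
Local Notation C := (Q1 A).
Local Notation F := (free_group (xG A)).
Variables (f f' : xmod2_map C D).
Implicit Types (h : homotopy f f') (u v : F) (k : xG A -> xL D).

Definition kfill h k : F -> simplexG D :=
  fg_lift (fun x => (phi f (fg_gen x), (1, (hs h (fg_gen x), k x))) : simplexG D).
Definition kext h k u := (kfill h k u).2.2.2.

Lemma kfillM h k : {morph kfill h k : u v / u * v}.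
Proof. exact: fg_liftM. Qed.

Lemma kfillE h k u : kfill h k u = filler (hid f) h (kext h k) u.
Proof.
have e0 : face0 (kfill h k u) = hsrc (hid f) u.
  apply: (fg_morph_eq (m := fun v => face0 (kfill h k v))) => [x y||x].
  - by rewrite kfillM.
  - exact: (hsrcM (hid f)).
  - by rewrite /kfill fg_lift_gen.
have e1 : face1 (kfill h k u) = hsrc h u.
  apply: (fg_morph_eq (m := fun v => face1 (kfill h k v))) => [x y||x].
  - by rewrite kfillM face1M.
  - exact: (hsrcM h).
  - by rewrite /kfill fg_lift_gen /face1 /= bdry1 mulg1.
rewrite /filler /kext; move: e0 e1.
by case: (kfill h k u) => [g [s [s' w]]] [-> ->] [_ ->].
Qed.

Lemma kext_fillerM h k : {morph filler (hid f) h (kext h k) : u v / u * v}.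
Proof. by move=> u v; rewrite -!kfillE kfillM. Qed.

Lemma kext_gen h k x : kext h k (fg_gen x) = k x.
Proof. by rewrite /kext /kfill fg_lift_gen. Qed.

Lemma kextM h k u v : kext h k (u * v) =
  ((hs h v)^-1 |>* (phi f v)^-1 |>L kext h k u) * kext h k v.
Proof.
have := congr1 (fun z : simplexG D => z.2.2.2) (kext_fillerM h k u v).
by rewrite /= !invg1 lift1g invg1 mul1g pact1.
Qed.

Lemma kext_unique h k (w : F -> xL D) :
    (forall u v, w (u * v) = ((hs h v)^-1 |>* (phi f v)^-1 |>L w u) * w v) ->
    (forall x, w (fg_gen x) = k x) ->
  w =1 kext h k.
Proof.
move=> wM w1 u.
suff e : filler (hid f) h w u = filler (hid f) h (kext h k) u.
  exact: (congr1 (fun z : simplexG D => z.2.2.2) e).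
apply: fg_morph_eq => [x y||x].
- rewrite sdM; congr (_, _); first exact: phiM.
  by apply: pathE_eq; rewrite /= ?hs_gM ?wM !unitsE.
- exact: kext_fillerM.
- by rewrite /filler w1 kext_gen.
Qed.

(* Since hid f is trivial, the pasting is t |-> (kext h k)^-1 t, which is the
   target of the 2-fold homotopy k with source h. *)
Definition twist h k : homotopy f f' := paste_homotopy (kext_fillerM h k).

Lemma hs_twist h k u : hs (twist h k) u = hs h u * xdelta (kext h k u).
Proof. by rewrite /= /paste_s mul1g. Qed.

Lemma ht_twist h k a : ht (twist h k) a = (kext h k (xbdry a))^-1 * ht h a.
Proof. by rewrite /= /paste_t pact_g1 mulg1. Qed.

Lemma twist_eq h k k' : kext h k =1 kext h k' -> twist h k = twist h k'.
Proof.
by move=> e; apply: homotopy_eq => x; rewrite ?hs_twist ?ht_twist e.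
Qed.

(** Solved from [kextM] at [[x]^-1 [x] = 1]; it accounts for the innermost term of [Xi]. *)
Lemma kextV h k x : kext h k (fg_gen x)^-1 =
  phi f (fg_gen x) |>L (hs h (fg_gen x) |>* (k x)^-1).
Proof.
have := kextM h k (fg_gen x)^-1 (fg_gen x).
rewrite kext_gen mulVg.
have -> : kext h k 1 = 1.
  have [e _] := morph_id_inv (kext_fillerM h k).
  exact: (congr1 (fun z : simplexG D => z.2.2.2) e).
move/(congr1 (fun l => l * (k x)^-1)); rewrite mulgK mul1g.
move/(congr1 (fun l => phi f (fg_gen x) |>L (hs h (fg_gen x) |>* l))) ->.
by rewrite pactVK gactA mulgV gact1.
Qed.

Lemma kext_one h : kext h (fun _ => 1) =1 fun _ => 1.
Proof.
move=> u; apply/esym; move: u; apply: kext_unique => // u v.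
by rewrite gact_one pact_g1 mulg1.
Qed.

(** The [xdelta] in [hs_twist] acts on L by conjugation, which makes the product of the two
    extensions obey the law of an extension along [h]. *)
Lemma kext_twist h k k' u :
  kext h (fun g => k g * k' g) u = kext h k u * kext (twist h k) k' u.
Proof.
apply/esym; move: u; apply: kext_unique => [u v|x]; last by rewrite !kext_gen.
rewrite !kextM hs_twist invgM -deltaV -!pactA !pact_delta !gactM !pactM.
by rewrite !gnorm.
Qed.

Lemma twist_twist h k k' : twist (twist h k) k' = twist h (fun g => k g * k' g).
Proof.
apply: homotopy_eq => x; rewrite ?hs_twist ?ht_twist kext_twist.
  by rewrite deltaM mulgA.
by rewrite invgM mulgA.
Qed.

Lemma twist_one h : twist h (fun _ => 1) = h.
Proof.
apply: homotopy_eq => x; rewrite ?hs_twist ?ht_twist kext_one.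
  by rewrite delta1 mulg1.
by rewrite invg1 mul1g.
Qed.

End Twist.

(** * Horizontal composition of 2-fold homotopies *)

Section TwistCompose.
Variables A D : xmod2.
Local Notation C := (Q1 A).
Variables (f1 f2 f3 : xmod2_map C D).

Definition hcomp_k (b : homotopy f2 f3) (k k' : xG A -> xL D) (g : xG A) : xL D :=
  ((hs b (fg_gen g))^-1 |>* k g) * k' g.

(** Taking [k'] or [k] trivial gives the two whiskerings. *)
Lemma hcomp1_twist (a : homotopy f1 f2) (b : homotopy f2 f3) k k' :
  hcomp1 (twist a k) (twist b k') = twist (hcomp1 a b) (hcomp_k b k k').
Proof.
(* The right-hand side is dictated by equating the L-components of the two homotopies. *)
have e u : kext (hcomp1 a b) (hcomp_k b k k') u =
    (gfill_w a b u)^-1 * ((hs b u)^-1 |>* kext a k u) * kext b k' u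
    * gfill_w (twist a k) (twist b k') u.
  apply/esym; move: u; apply: kext_unique => [u v|x]; last first.
    by rewrite !gfill_w_gen !kext_gen invg1 mul1g mulg1.
  rewrite !gfill_wM !kextM !hs_hcomp1 !hs_twist !hs_gM.
  rewrite !(phi_homotopyV a) -!gacteA -!gactA.
  move: (gfill_w a b u) (gfill_w (twist a k) (twist b k') u).
  move: (gfill_w a b v) (gfill_w (twist a k) (twist b k') v).
  move: (kext a k u) (kext a k v) (kext b k' u) (kext b k' v).
  move: (hs a u) (hs b u) (hs a v) (hs b v) (phi f1 v)^-1.
  move=> {}a {}b a' b' g.
  move=> ku kv ku' kv' w1 w2 w3 w4.
  rewrite !invgM -!deltaV !(gacteM, gacteV, gactM, gactV, gact_pact).
  rewrite -!xdelta_equiv ?gactV.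
  rewrite !lift_delta_mul !lift_mull !lift_delta_l.
  rewrite -?pactA !pact_delta !bdryE !pactN.
  by rewrite -!pactA !lift_expandVA -!pactA !pactN.
apply: homotopy_eq => [u|x].
  move: u; apply: hs_eq => x.
  rewrite hs_twist !hs_hcomp1_gen !hs_twist !kext_gen /hcomp_k.
  by rewrite deltaM delta_pact !gnorm.
rewrite ht_twist !ht_hcomp1 !ht_twist hs_twist e.
by rewrite !invgM -deltaV -!pactA !pact_delta !pactN.
Qed.

End TwistCompose.

(** * The 2-groupoid of lax homotopies *)

Section LaxCells.
Variables A D : xmod2.
Local Notation C := (Q1 A).
Implicit Types (f : xmod2_map A D).

Lemma phi_gen f (g : xG A) : phi (xmod2_comp f (proj A)) (fg_gen g) = phi f g.
Proof. by rewrite /= fg_proj_gen. Qed.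

Definition defect_word (g k : xG A) : free_group (xG A) :=
  (fg_gen (g * k))^-1 * fg_gen g * fg_gen k.

(** Both maps send [q1_defect g k] to 1, so in [homotopy_psi] the other two factors cancel. *)
Lemma hs_defect f f' (h : lax_homotopy f f') g k :
  (hs h (defect_word g k))^-1 = xdelta (hat_Pi h g k).
Proof.
have := homotopy_psi h (q1_defect g k).
by rewrite /= !gmulf1 mul1g => /esym/mulg1_eq.
Qed.

(** Solved from [gfill_wM] at [[g]^-1 [g] = 1]; the source of the last lifting in [Theta]. *)
Lemma gfill_w_genV f f' f'' (h : lax_homotopy f f') (h' : lax_homotopy f' f'') g :
  gfill_w h h' (fg_gen g)^-1 = (phi f g |>L {{hat_s h g, hat_s h' g}})^-1.
Proof.
have := gfill_wM h h' (fg_gen g)^-1 (fg_gen g).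
have -> : gfill_w h h' ((fg_gen g)^-1 * fg_gen g) = 1.
  rewrite mulVg.
  have [e _] := morph_id_inv (gfill_fillerM h h').
  exact: (congr1 (fun z : simplexG D => z.2.2.2) e).
rewrite gfill_w_gen mulg1 (derivationV _ (hs_derivation h')) !gacteV !invgK.
rewrite gacteA (homotopy_phi h) phi_gen mulKg -!/(hat_s _ _).
move/(congr1 (fun l => hat_s h g |>* (hat_s h' g |>* l))).
rewrite !pact_g1 pactVK pactM pactV pactVK lift_invl bdryV gacteA mulVg gacte1.
rewrite pactVK invgK => /esym/mulg1_eq.
move/(congr1 (fun l => phi f g |>L l)).
by rewrite gactA mulgV gact1 gactV.
Qed.

Lemma Theta_w f f' f'' (h : lax_homotopy f f') (h' : lax_homotopy f' f'') g k :
  Theta f f' (hat_s h) (hat_s h') (g * k) g k =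
  (gfill_w h h' (defect_word g k))^-1.
Proof.
rewrite /defect_word !gfill_wM gfill_w_genV !gfill_w_gen.
rewrite hs_gM (derivationV _ (hs_derivation h')) !phi_gen.
rewrite /Theta !pactE.
(* Values of [phi f'] are replaced by values of [phi f] and boundaries. *)
have ephi : phi f' (g * k) = phi f (g * k) * xbdry (hat_s h (g * k)).
  by rewrite -!phi_gen (homotopy_phi h).
have ephi1 : (phi f' (g * k))^-1 =
    xbdry ((hat_s h k)^-1 * ((phi f k)^-1 |>E (hat_s h g)^-1))
    * (phi f (g * k))^-1.
  rewrite bdryM xbdry_equiv !phiM -!phi_gen !(homotopy_phi h) phi_gen !bdryV.
  by rewrite !gnorm.
have ephi2 : (phi f' k)^-1 = xbdry (hat_s h k)^-1 * (phi f k)^-1.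
  by rewrite -!phi_gen (homotopy_phi h) invgM bdryV.
rewrite ephi1 ephi2 ephi -!/(hat_s h _) -!/(hat_s h' _).
have -> : phi f' g = phi f g * xbdry (hat_s h g).
  by rewrite -!phi_gen (homotopy_phi h).
have -> : phi f g = phi f (g * k) * (phi f k)^-1 by rewrite phiM mulgK.
move: (phi f (g * k)) (phi f k) (hat_s h g) (hat_s h k) (hat_s h (g * k)).
move: (hat_s h' g) (hat_s h' k) (hat_s h' (g * k)).
move=> sg' sk' sx' px pk sg sk sx.
(* The values at [g] enter through their translates by [pk^-1], which become the new variables. *)
have -> : sg = pk |>E (pk^-1 |>E sg) by rewrite gacteA mulgV gacte1.
have -> : sg' = pk |>E (pk^-1 |>E sg') by rewrite gacteA mulgV gacte1.
move: (pk^-1 |>E sg) (pk^-1 |>E sg') => a a'.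
rewrite !invgM mulVg gacte1 -(delta_lift sx sx') lift_delta_mul !lift_mull.
rewrite !(xbdry_equiv, bdryE, gact_pact, gact_lift, gactM).
rewrite !(pactN, xbdry_equiv, bdryE, gacteM, gact_one, @pact_g1 D, @invg1) lift_mulr.
by rewrite !bdryE -!pactA !lift_expandVV -?pactA !(pactM, pactV, pactA) !pactN.
Qed.

(** By [hs_defect], the derivation of [h'] acts here as conjugation by [hat_Pi h' g k]; this puts
    [hat_Pi h'] before [hat_Pi h]. *)
Lemma hat_Pi_hcomp1 f f' f'' (h : lax_homotopy f f') (h' : lax_homotopy f' f'') g k :
  hat_Pi (hcomp1 h h') g k =
    Theta f f' (hat_s h) (hat_s h') (g * k) g k * hat_Pi h' g k * hat_Pi h g k.
Proof.
rewrite Theta_w /hat_Pi ht_hcomp1 hs_defect pact_delta /hat_Pi.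
by rewrite !gnorm.
Qed.

Lemma hat_t_hcomp1 f f' f'' (h : lax_homotopy f f') (h' : lax_homotopy f' f'') e :
  hat_t (hcomp1 h h') e = ((hat_s h' (xbdry e))^-1 |>' hat_t h e) * hat_t h' e.
Proof.
by rewrite /hat_t ht_hcomp1 gfill_w_gen invg1 mul1g pactE.
Qed.

Lemma hat_s_hcomp1 f f' f'' (h : lax_homotopy f f') (h' : lax_homotopy f' f'') g :
  hat_s (hcomp1 h h') g = hat_s h g * hat_s h' g.
Proof. exact: hs_hcomp1_gen. Qed.

(** The derivations agree on the basis, and the homomorphisms [hpath] on the generators of the fibre
    product. *)
Lemma lax_homotopy_eq f f' (h h' : lax_homotopy f f') :
  hat_s h =1 hat_s h' -> hat_t h =1 hat_t h' ->
  (forall g k, hat_Pi h g k = hat_Pi h' g k) -> h = h'.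
Proof.
move=> es et ePi; have eh : hs h =1 hs h' by apply: hs_eq.
apply: homotopy_eq => // a.
suff : hpath h a = hpath h' a by case.
apply: (fibprod_morph_eq (m := hpath h) (m' := hpath h')) => [||e|g k].
- exact: (hpathM h).
- exact: (hpathM h').
- by rewrite /hpath /path_map eh; congr (_, (_, _)); apply: et.
- by rewrite /hpath /path_map eh; congr (_, (_, _)); apply: ePi.
Qed.

Lemma Xi_kext f f' (h : lax_homotopy f f') k g g' :
  kext h k (defect_word g g') = Xi f (hat_s h) k (g * g') g g'.
Proof.
rewrite /defect_word !kextM kextV !kext_gen !phi_gen /Xi !pactE.
by rewrite gactA.
Qed.

Lemma hat_s_twist f f' (h : lax_homotopy f f') k g :
  hat_s (twist h k) g = hat_s h g * xdelta (k g).
Proof. by rewrite /hat_s hs_twist kext_gen. Qed.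

Lemma hat_t_twist f f' (h : lax_homotopy f f') k e :
  hat_t (twist h k) e = (k (xbdry e))^-1 * hat_t h e.
Proof. by rewrite /hat_t ht_twist kext_gen. Qed.

Lemma hat_Pi_twist f f' (h : lax_homotopy f f') k g g' :
  hat_Pi (twist h k) g g' =
    (Xi f (hat_s h) k (g * g') g g')^-1 * hat_Pi h g g'.
Proof. by rewrite /hat_Pi ht_twist Xi_kext. Qed.

Lemma lax2_target f f' (h h' : lax_homotopy f f') (m : lax_2homotopy h h') :
  h' = twist h m.
Proof.
apply: lax_homotopy_eq => [g|e|g k].
- by rewrite hat_s_twist (lax2_s m).
- by rewrite hat_t_twist (lax2_t m).
- by rewrite hat_Pi_twist (lax2_Pi m).
Qed.

(** An equation specifies the target, so it may be any homotopy provably equal to a twist, such as a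
    composite. *)
Definition lax2_twist f f' (h h' : lax_homotopy f f') (k : xG A -> xL D)
  (e : h' = twist h k) : lax_2homotopy h h'.
Proof.
by exists k => [g|x|g g']; rewrite e ?hat_s_twist ?hat_t_twist ?hat_Pi_twist.
Defined.

Lemma lax2_eq f f' (h h' : lax_homotopy f f') (m n : lax_2homotopy h h') :
  m =1 n -> m = n.
Proof.
case: m n => [k s t p] [k' s' t' p'] /= /functional_extensionality e.
by subst k'; congr Lax2Homotopy; apply: proof_irrelevance.
Qed.

Lemma pack2_eq f f' (a b a' b' : lax_homotopy f f') (m : lax_2homotopy a b)
    (m' : lax_2homotopy a' b') :
  a = a' -> b = b' -> m =1 m' -> pack2 m = pack2 m'.
Proof. by move=> ea eb; subst a' b' => /lax2_eq ->. Qed.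

Definition lax2_id f f' (h : lax_homotopy f f') : lax_2homotopy h h :=
  lax2_twist (esym (twist_one h)).

Fact lax2_vcomp_subproof f f' (h h' h'' : lax_homotopy f f')
    (m : lax_2homotopy h h') (n : lax_2homotopy h' h'') :
  h'' = twist h (fun g => m g * n g).
Proof. by rewrite -twist_twist -(lax2_target m) -(lax2_target n). Qed.
Definition lax2_vcomp f f' (h h' h'' : lax_homotopy f f')
  (m : lax_2homotopy h h') (n : lax_2homotopy h' h'') : lax_2homotopy h h'' :=
  lax2_twist (lax2_vcomp_subproof m n).

Fact lax2_inv_subproof f f' (h h' : lax_homotopy f f') (m : lax_2homotopy h h') :
  h = twist h' (fun g => (m g)^-1).
Proof.
have e := lax2_target m; move: (hat_k m) e => k ->.
rewrite twist_twist -[LHS]twist_one; apply: twist_eq => u.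
by congr (kext _ _ u); apply: functional_extensionality => g; rewrite mulgV.
Qed.

Fact lax2_hcomp_subproof f f' f'' (a a' : lax_homotopy f f')
    (b b' : lax_homotopy f' f'') (m : lax_2homotopy a a') (n : lax_2homotopy b b') :
  hcomp1 a' b' = twist (hcomp1 a b) (hcomp_k b m n).
Proof. by rewrite -hcomp1_twist -(lax2_target m) -(lax2_target n). Qed.
Definition lax2_hcomp f f' f'' (a a' : lax_homotopy f f')
  (b b' : lax_homotopy f' f'') (m : lax_2homotopy a a') (n : lax_2homotopy b b') :
  lax_2homotopy (hcomp1 a b) (hcomp1 a' b') :=
  lax2_twist (lax2_hcomp_subproof m n).

End LaxCells.

Definition hom_lax (A A' : xmod2) :
  @strict_2groupoid (xmod2_map A A') (@lax_homotopy A A') (@lax_2homotopy A A').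
Proof.
refine (@Strict2Groupoid _ _ _ (fun f => hid _) (fun f f' f'' h h' => hcomp1 h h')
  (@lax2_id A A') (@lax2_vcomp A A') (@lax2_hcomp A A') _ _ _ _ _ _ _ _ _ _ _ _ _).
- by move=> f1 f2 f3 f4 a b c; apply: hcomp1A.
- by move=> f f' a; apply: hcomp1_idl.
- by move=> f f' a; apply: hcomp1_idr.
- by move=> f f' a; apply: hcomp1_inv2.
- by move=> f f' a b c d m n p; apply: lax2_eq => g /=; rewrite mulgA.
- by move=> f f' a b m; apply: lax2_eq => g /=; rewrite mul1g.
- by move=> f f' a b m; apply: lax2_eq => g /=; rewrite mulg1.
- move=> f f' a b m; exists (lax2_twist (lax2_inv_subproof m)).
  by split; apply: lax2_eq => g /=; rewrite ?mulgV ?mulVg.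
- move=> f f' f'' a b; apply: lax2_eq => g /=.
  by rewrite /hcomp_k pact_g1 mulg1.
- move=> f f' f'' a a' a'' b b' b'' m m' n n'; apply: lax2_eq => g /=.
  (* Interchange: the derivations of [b] and [b'] differ by [xdelta (n g)], which acts by
     conjugation and swaps the middle factors. *)
  rewrite /hcomp_k -!/(hat_s _ g) (lax2_s n) invgM -deltaV -pactA pact_delta pactM.
  by rewrite !gnorm.
- move=> f1 f2 f3 f4 a a' b b' c c' m n p.
  apply: pack2_eq => [||g /=]; [exact: hcomp1A..|].
  by rewrite /hcomp_k hs_hcomp1_gen invgM -pactA pactM mulgA.
- move=> f f' a a' m; apply: pack2_eq => [||g /=]; [exact: hcomp1_idl..|].
  by rewrite /hcomp_k pact_g1 mul1g.
- move=> f f' a a' m; apply: pack2_eq => [||g /=]; [exact: hcomp1_idr..|].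
  by rewrite /hcomp_k invg1 pact1 mulg1.
Defined.

Theorem theorem61 (A A' : xmod2) :
  exists C : @strict_2groupoid (xmod2_map A A') (@lax_homotopy A A')
               (@lax_2homotopy A A'),
  (* (1) composition of lax homotopies *)
  (forall (f f' f'' : xmod2_map A A')
      (h : lax_homotopy f f') (h' : lax_homotopy f' f''),
    [/\ forall g, hat_s (comp1 C h h') g = hat_s h g * hat_s h' g,
        forall e, hat_t (comp1 C h h') e =
          ((hat_s h' (xbdry e))^-1 |>' hat_t h e) * hat_t h' e
      & forall g k, hat_Pi (comp1 C h h') g k =
          Theta f f' (hat_s h) (hat_s h') (g * k) g k
          * hat_Pi h' g k * hat_Pi h g k]) /\
  (* (2) vertical composition of lax 2-fold homotopies *)
  (forall (f f' : xmod2_map A A') (h h' h'' : lax_homotopy f f')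
      (k : lax_2homotopy h h') (k' : lax_2homotopy h' h'') g,
    vcomp C k k' g = k g * k' g) /\
  (* (3) whiskerings *)
  (forall (f f' f'' : xmod2_map A A') (h h' : lax_homotopy f f')
      (k : lax_2homotopy h h') (h'' : lax_homotopy f' f'') g,
    whisker_right C k h'' g = (hat_s h'' g)^-1 |>' k g) /\
  (forall (f f' f'' : xmod2_map A A') (h h' : lax_homotopy f f')
      (k : lax_2homotopy h h') (h'' : lax_homotopy f'' f) g,
    whisker_left C h'' k g = k g).
Proof.
exists (hom_lax A A'); split; [|split; [|split]].
- move=> f f' f'' h h'; split=> *.
  + exact: hat_s_hcomp1.
  + exact: hat_t_hcomp1.
  + exact: hat_Pi_hcomp1.
- by [].
- by move=> f f' f'' h h' k h'' g; rewrite /= /hcomp_k mulg1 pactE.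
- by move=> f f' f'' h h' k h'' g; rewrite /= /hcomp_k pact_g1 mul1g.
Qed.
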